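(* Let $n \geq 3$ and let $X = \bigcap_{i=1}^k V_i \subset \mathbb{P}^{k+n-1}$ be a Fano complete intersection, where $V_i$ is a hypersurface of degree $n_i > 1$, with $\sum_{i=1}^k n_i = d \leq k+n-1$. Then $X$ is swept by quadratic rational curves when $d = k+n-1$, and by lines when $d < k+n-1$.
   Context: $\mathbb{P}^{k+n-1}$ is complex projective space, and $k \geq 1$ is the number of hypersurfaces. That $X$ is a complete intersection means that the intersection of the $k$ hypersurfaces $V_i$ has dimension $n-1$; the Fano condition is the inequality $d \leq k+n-1$. A quadratic rational curve is a rational curve of degree two in $\mathbb{P}^{k+n-1}$, and a line is a rational curve of degree one in $\mathbb{P}^{k+n-1}$. ''$X$ is swept by'' curves of a given kind means that curves of that kind contained in $X$ cover $X$.
   Formalization: ''Quadratic rational curve'' means the image of a degree-two morphism from the projective line, so a line covered twice also counts; otherwise the claim fails, e.g. for the cone over a smooth plane cubic, whose only rational curves are lines. *)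

(* Defs.v *)
From HB Require Import structures.
From mathcomp Require Import all_boot all_order all_algebra.
From mathcomp Require Import classical_sets reals complex mpoly.

Set Implicit Arguments.
Unset Strict Implicit.
Unset Printing Implicit Defensive.

Import GRing.Theory.
Local Open Scope ring_scope.
Local Open Scope classical_set_scope.

Section ProjectiveGeometry.
Variable K : closedFieldType.

(* Points of P^N are the lines through the origin of K^(N+1). *)
Definition pspace (N : nat) : Type :=
  {L : {vspace 'rV[K]_N.+1} | \dim L == 1%N}.

Definition coords (m : nat) (v : 'rV[K]_m) : 'I_m -> K := fun j => v 0 j.

(* Only meaningful for homogeneous F, for which any one nonzero representative
   of p decides membership. *)
Definition hypersurface (N : nat) (F : {mpoly K[N.+1]}) : set (pspace N) :=
  [set p : pspace N |
    forall v : 'rV[K]_N.+1, v \in sval p -> v != 0 -> F.@[coords v] = 0].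

Definition zariski_closed (N : nat) (Z : set (pspace N)) : Prop :=
  exists S : set {mpoly K[N.+1]},
    (forall F, S F -> exists e : nat, F \is e.-homog) /\
    Z = \bigcap_(F in S) hypersurface F.

Definition zariski_irreducible (N : nat) (Z : set (pspace N)) : Prop :=
  Z !=set0 /\
  forall A B : set (pspace N), zariski_closed A -> zariski_closed B ->
    Z `<=` A `|` B -> Z `<=` A \/ Z `<=` B.

Definition irreducible_chain (N : nat) (X : set (pspace N)) (m : nat)
    (Z : nat -> set (pspace N)) : Prop :=
  (forall i, (i <= m)%N ->
     [/\ zariski_closed (Z i), zariski_irreducible (Z i) & Z i `<=` X]) /\
  (forall i, (i < m)%N -> Z i `<` Z i.+1).

(* Krull dimension of X, for X Zariski closed: closed subsets of X are then
   the closed subsets of P^N contained in X. *)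
Definition has_dimension (N : nat) (X : set (pspace N)) (m : nat) : Prop :=
  (exists Z, irreducible_chain X m Z) /\
  (forall m' Z, irreducible_chain X m' Z -> (m' <= m)%N).

Definition param (N : nat) (f : 'I_N.+1 -> {mpoly K[2]}) (u : 'rV[K]_2) :
    'rV[K]_N.+1 := \row_j (f j).@[coords u].

(* The image of a morphism f : P^1 -> P^N with f^* O(1) = O(e), e > 0.  The
   degree is that of the parametrization, i.e. of the cycle f_*[P^1]: for e = 1
   the curves are exactly the lines; for e = 2 they are the smooth conics and
   the lines taken with multiplicity two.  Multiple lines cannot be left out:
   a cone over a smooth plane cubic contains no smooth conic, and no smooth
   conic of a smooth cubic surface passes through an Eckardt point. *)
Definition rational_curve (N e : nat) (C : set (pspace N)) : Prop :=
  (0 < e)%N /\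
  exists f : 'I_N.+1 -> {mpoly K[2]},
    [/\ forall j, f j \is e.-homog,
        forall u, u != 0 -> param f u != 0
      & C = [set p : pspace N | exists2 u, u != 0 & sval p = <[param f u]>%VS]].

Definition swept_by (N : nat) (curve : set (pspace N) -> Prop)
    (X : set (pspace N)) : Prop :=
  forall p, X p -> exists C, [/\ curve C, C `<=` X & C p].

Definition line (N : nat) : set (pspace N) -> Prop :=
  @rational_curve N 1.

Definition quadratic_rational_curve (N : nat) : set (pspace N) -> Prop :=
  @rational_curve N 2.

End ProjectiveGeometry.

(* Main.v *)
Require Import Defs.
From HB Require Import structures.
From mathcomp Require Import all_boot all_order all_algebra.
From mathcomp Require Import boolp classical_sets reals complex mpoly.
From mathcomp Require Import ring zify.

(* Fix p in X with representative p0, put N = k + n - 1 and let y range over a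
   complement of p0.  The line through p in the direction y lies in X iff the
   coefficients of F_i(X p0 + y) below X^(n_i) vanish at y: these are d forms
   in N variables, so a line exists when d < N.

   Let d = N and suppose that X contains no line through p.  A conic through p
   is s |-> (s^2 - c) p0 + s v + w with v, w in the complement.  The degenerate
   solutions v = w = 0 cannot be removed by counting equations, so suppose that
   they are the only ones for c = 0 and c = 1.  Let f be the 2N coefficients of
   the F_i((X^2 - 1) p0 + v X + w), viewed as polynomials in (v, w), and let
   rho be the rank of K[v, w] over K[f].
   - Give v weight 1 and w weight 2.  The top form of the coefficient of X^j has
     weight 2 n_i - j and is the same coefficient for c = 0.  The top forms have
     only the trivial zero, hence K[v, w] is finite over K[f] and comparing the
     growth of both sides gives rho >= \prod_i (2 n_i)! / 2^N.
   - K[f] is also generated by the Taylor coefficients of order j < n_i at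
     X = 1 and X = -1.  Their lowest forms, of degree n_i - j, are coefficients
     of F_i(2 X p0 + w + v) and F_i(- 2 X p0 + w - v), which have only the
     trivial zero because there is no line.  Truncating at a high power of the
     maximal ideal of the origin gives rho <= \prod_i (n_i!)^2.
   Since 2^m (m!)^2 < (2m)! for m > 1, this is a contradiction.

   A parametrization that vanishes somewhere splits off a linear form and
   leaves a line through p; lines are traversed twice to get degree 2. *)

Set Implicit Arguments.
Unset Strict Implicit.
Unset Printing Implicit Defensive.

Import GRing.Theory.
Local Open Scope ring_scope.

(** * Nullstellensatz *)

Definition is_ideal (A : comNzRingType) (I : A -> Prop) : Prop :=
  [/\ I 0, forall x y, I x -> I y -> I (x + y) & forall a x, I x -> I (a * x)].

Lemma ideal_sum (A : comNzRingType) (I : A -> Prop) (T : Type) (r : seq T)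
    (P : pred T) (F : T -> A) :
  is_ideal I -> (forall i, P i -> I (F i)) -> I (\sum_(i <- r | P i) F i).
Proof. by case=> I0 ID _ IF; elim/big_ind: _ => //. Qed.

(** As [f] is monic, [ev] preserves its size. The image of the remainder is a multiple of the image
    of [f] of smaller size, hence zero in a domain. *)
Lemma map_rmodp_monic (A : comNzRingType) (K : idomainType)
    (ev : {rmorphism A -> K}) (f p : {poly A}) :
  f \is monic -> map_poly ev p = 0 -> map_poly ev (Pdiv.Ring.rmodp p f) = 0.
Proof.
move=> fmon p0; have := Pdiv.RingMonic.rdivp_eq fmon p.
move/(congr1 (map_poly ev)); rewrite rmorphD rmorphM /= p0.
set q := map_poly ev (Pdiv.Ring.rdivp p f); set r := map_poly ev (Pdiv.Ring.rmodp p f) => E.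
have szf : size (map_poly ev f) = size f.
  by apply: size_map_poly_id0; rewrite (monicP fmon) rmorph1 oner_neq0.
have szr : (size r < size f)%N.
  by apply: leq_ltn_trans (size_poly _ _) _; apply: Pdiv.Ring.ltn_rmodpN0; apply: monic_neq0.
have [q0|qn0] := eqVneq q 0; first by move: E; rewrite q0 mul0r add0r.
have fn0 : map_poly ev f != 0 by rewrite -size_poly_gt0 szf size_poly_gt0 monic_neq0.
have rE : r = - (q * map_poly ev f) by apply/eqP; rewrite -addr_eq0 addrC -E.
move: szr; rewrite rE size_polyN size_mul // szf.
by have := qn0; rewrite -size_poly_gt0; case: (size q) => // s _; rewrite addSn /= ltnNge leq_addl.
Qed.

(* Modulo the monic f, multiplication by 1 - g is a matrix with entries in
   the kernel of ev, so the determinant below is a unit at ev and lies in I. *)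
Lemma ideal_map_neq1 (A : comNzRingType) (K : idomainType)
    (ev : {rmorphism A -> K}) (I : {poly A} -> Prop) (f g : {poly A}) :
  is_ideal I -> I f -> f \is monic -> (forall a : A, I a%:P -> ev a = 0) ->
  I g -> map_poly ev g <> 1.
Proof.
move=> [I0 ID IM] If fmon Iev Ig g1.
have szf : (0 < size f)%N by rewrite size_poly_gt0 monic_neq0.
set D := (size f).-1.
have [D0|Dpos] := posnP D.
  have f1 : f = 1.
    have/size1_polyC fC : (size f <= 1)%N by rewrite -(prednK szf) -/D D0.
    by move: fmon; rewrite fC monicE lead_coefC => /eqP ->.
  by move: (Iev 1); rewrite polyC1 -f1 => /(_ If) /eqP; rewrite rmorph1 oner_eq0.
pose rm (k : nat) := Pdiv.Ring.rmodp ('X^k * (1 - g)) f.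
pose B : 'M[A]_D := \matrix_(k, l) ((k == l)%:R - (rm k)`_l).
have evB : map_mx ev B = 1%:M.
  apply/matrixP => k l; rewrite !mxE rmorphB rmorph_nat.
  suff -> : ev (rm k)`_l = 0 by rewrite subr0.
  rewrite -coef_map map_rmodp_monic ?coef0 //.
  by rewrite rmorphM rmorphB /= g1 rmorph1 subrr mulr0.
pose v : 'cV[{poly A}]_D := \col_l 'X^l.
(* Modulo [f] this entry is X^k g; Cramer's rule will then put [\det B] times X^0 = 1 in [I]. *)
have BvI k : I ((map_mx polyC B *m v) k 0).
  have -> : (map_mx polyC B *m v) k 0 = 'X^k - rm k.
    rewrite !mxE; under eq_bigr => l _ do rewrite !mxE polyCB mulrBl.
    rewrite sumrB (bigD1 k) //= eqxx polyC1 mul1r big1 ?addr0; last first.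
      by move=> l /negPf lk; rewrite eq_sym lk polyC0 mul0r.
    congr (_ - _); rewrite [RHS](_ : _ = \poly_(i < D) (rm k)`_i).
      by rewrite poly_def; apply: eq_bigr => l _; rewrite mul_polyC.
    apply/polyP => i; rewrite coef_poly; case: ltnP => // Di.
    apply: nth_default; apply: leq_trans Di.
    by rewrite -ltnS /D prednK //; apply: Pdiv.Ring.ltn_rmodpN0; apply: monic_neq0.
  have -> : 'X^k - rm k = 'X^k * g + Pdiv.Ring.rdivp ('X^k * (1 - g)) f * f.
    have := Pdiv.RingMonic.rdivp_eq fmon ('X^k * (1 - g)); rewrite -/(rm k).
    move: (rm k) (Pdiv.Ring.rdivp _ _) => r q E.
    have -> : r = 'X^k * (1 - g) - q * f by rewrite E addrC addKr.
    ring.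
  by apply: ID; apply: IM.
have detI : I (\det B)%:P.
  pose o : 'I_D := Ordinal Dpos.
  have E : (\det B)%:P = ((\adj (map_mx polyC B) *m (map_mx polyC B *m v))) o 0.
    rewrite mulmxA mul_adj_mx mul_scalar_mx !mxE det_map_mx /= expr0 mulr1 //.
  rewrite E mxE; apply: ideal_sum; first by split.
  by move=> l _; apply: IM.
by have /eqP := Iev _ detI; rewrite -det_map_mx evB det1 oner_eq0.
Qed.

(** Applying [ev] to coefficients turns [I] into an ideal [J] of [{poly K}], where [sec] provides
    stability under multiplication. It is nonzero because [f] is monic and proper by
    [ideal_map_neq1], so its generator, an element [d] of least size, has a root. *)
Lemma ideal_extend_zero (K : closedFieldType) (A : comNzRingType)
    (ev : {rmorphism A -> K}) (sec : {rmorphism K -> A})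
    (I : {poly A} -> Prop) (f : {poly A}) :
  cancel sec ev -> is_ideal I -> I f -> f \is monic ->
  (forall a : A, I a%:P -> ev a = 0) ->
  exists xi, forall g, I g -> (map_poly ev g).[xi] = 0.
Proof.
move=> secK idI If fmon Iev; case: (idI) => I0 ID IM.
pose J (h : {poly K}) := exists2 g, I g & map_poly ev g = h.
have JM a h : J h -> J (a * h).
  case=> g Ig <-; exists (map_poly sec a * g); first exact: IM.
  rewrite rmorphM /= -map_poly_comp; congr (_ * _).
  by rewrite map_poly_id // => x _ /=; rewrite secK.
have JD h1 h2 : J h1 -> J h2 -> J (h1 + h2).
  case=> g1 Ig1 <- [g2 Ig2 <-]; exists (g1 + g2); first exact: ID.
  by rewrite rmorphD.
have J1 : ~ J 1 by case=> g Ig; apply: ideal_map_neq1 If fmon Iev Ig.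
have exd : exists n, `[< exists h, [/\ J h, h != 0 & size h = n] >].
  exists (size (map_poly ev f)); apply/asboolP; exists (map_poly ev f); split => //.
    by exists f.
  rewrite -size_poly_gt0 size_map_poly_id0 ?size_poly_gt0 ?monic_neq0 //.
  by rewrite (monicP fmon) rmorph1 oner_neq0.
case: (ex_minnP exd) => n /asboolP [d [Jd dn0 sd]] dmin.
have d1 : size d != 1%N.
  apply/eqP => d1; apply: J1.
  have /size1_polyC dC : (size d <= 1)%N by rewrite d1.
  have c0 : d`_0 != 0 by rewrite -polyC_eq0 -dC.
  have -> : 1 = (d`_0)^-1%:P * d by rewrite {2}dC -polyCM mulVf.
  exact: JM.
have [xi /rootP rxi] := closed_rootP d d1; exists xi => g Ig.
have Jg : J (map_poly ev g) by exists g.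
set h := map_poly ev g in Jg *.
have Jr : J (h %% d).
  have -> : h %% d = h + (- (h %/ d)) * d by rewrite {2}(divp_eq h d); ring.
  by apply: JD => //; apply: JM.
have r0 : h %% d = 0.
  apply/eqP; apply/negPn/negP => rn0.
  have /dmin : `[< exists h', [/\ J h', h' != 0 & size h' = size (h %% d)] >].
    by apply/asboolP; exists (h %% d).
  by rewrite -sd leqNgt ltn_modp dn0.
by rewrite (divp_eq h d) r0 addr0 hornerM rxi mulr0.
Qed.

Lemma mpoly_rmorph_eq (R : comNzRingType) (S : comNzRingType) (n : nat)
    (g1 g2 : {rmorphism {mpoly R[n]} -> S}) :
  (forall c, g1 c%:MP = g2 c%:MP) -> (forall i, g1 'X_i = g2 'X_i) -> g1 =1 g2.
Proof.
move=> gC gX p; rewrite [p]mpolyE !rmorph_sum; apply: eq_bigr => m _ /=.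
rewrite -mul_mpolyC !rmorphM gC mpolyXE_id !rmorph_prod; congr (_ * _).
by apply: eq_bigr => i _; rewrite !rmorphXn gX.
Qed.

(** Serves twice: with [j0 = ord_max] in changes of variables, and with [j0] a nonzero coordinate of
    a vector, where the values form a complement of that vector. *)
Definition insert0 (n : nat) (j0 : 'I_n.+1) (A : nzRingType) (a : 'I_n -> A)
    (i : 'I_n.+1) : A := if unlift j0 i is Some j then a j else 0.

Section ChangeOfVariables.
Variables (K : fieldType) (n : nat) (lam : 'I_n.+1 -> K).

(** Noether's linear substitution, which makes a given polynomial monic in ['X] up to a constant for
    general [lam]. When [lam] is the last unit vector it only renames the last variable to ['X]. *)
Definition mpoly_to_uni : {mpoly K[n.+1]} -> {poly {mpoly K[n]}} :=
  mmap (@polyC _ \o @mpolyC n K)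
    (fun i => insert0 ord_max (fun j => ('X_j)%:P) i + (lam i)%:MP *: 'X).

HB.instance Definition _ :=
  GRing.RMorphism.copy mpoly_to_uni (mmap (@polyC _ \o @mpolyC n K) _).

Let y : {mpoly K[n.+1]} := (lam ord_max)^-1 *: 'X_ord_max.

Definition uni_to_mpoly : {poly {mpoly K[n]}} -> {mpoly K[n.+1]} :=
  horner_eval y \o
  map_poly (mmap (@mpolyC n.+1 K)
    (fun j => 'X_(lift ord_max j) - lam (lift ord_max j) *: y)).

HB.instance Definition _ := GRing.RMorphism.copy uni_to_mpoly (_ \o _).

Lemma mpoly_to_uniK : lam ord_max != 0 -> cancel mpoly_to_uni uni_to_mpoly.
Proof.
move=> lam0; apply: (mpoly_rmorph_eq (g1 := uni_to_mpoly \o mpoly_to_uni) (g2 := idfun)) => [c|i] /=.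
  rewrite /mpoly_to_uni mmapC /= /uni_to_mpoly /= map_polyC /= mmapC.
  by rewrite /horner_eval hornerC.
rewrite /mpoly_to_uni mmapX mmap1U /uni_to_mpoly /= /horner_eval.
rewrite rmorphD /= -mul_polyC rmorphM /= map_polyC map_polyX /= mmapC.
rewrite hornerD hornerM hornerX hornerC /insert0.
case: unliftP => [j ->|->].
  by rewrite map_polyC /= mmapX mmap1U hornerC mul_mpolyC subrK.
by rewrite map_polyC /= mmap0 hornerC add0r /y mul_mpolyC scalerA mulfV // scale1r.
Qed.

Lemma eval_mpoly_to_uni (a : 'I_n -> K) (xi : K) f :
  (map_poly (meval a) (mpoly_to_uni f)).[xi] =
  f.@[fun i => insert0 ord_max a i + lam i * xi].
Proof.
pose ev : {poly {mpoly K[n]}} -> K := horner_eval xi \o map_poly (meval a).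
apply: (mpoly_rmorph_eq (g1 := horner_eval xi \o (map_poly (meval a) \o mpoly_to_uni))
  (g2 := meval _)) => [c|i] /=.
  by rewrite /mpoly_to_uni mmapC /= map_polyC /= /horner_eval hornerC !mevalC.
rewrite /mpoly_to_uni mmapX mmap1U mevalXU /horner_eval.
rewrite rmorphD /= -mul_polyC rmorphM /= map_polyC map_polyX /= mevalC.
rewrite hornerD hornerM hornerX hornerC /insert0; congr (_ + _).
by case: unliftP => [j _|_]; rewrite map_polyC hornerC /= ?mevalXU ?meval0.
Qed.

End ChangeOfVariables.

(** By induction some point keeps the leading coefficient in the last variable nonzero; the last
    coordinate is then chosen off the finitely many roots. *)
Lemma mpoly_neq0_point (K : closedFieldType) (n : nat) (f : {mpoly K[n]}) :
  f != 0 -> exists x, f.@[x] != 0.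
Proof.
elim: n f => [|n IH] f fn0.
  exists (fun=> 0); move: fn0; rewrite (nvar0_mpolyC f) mevalC.
  by apply: contraNneq => ->; rewrite mpolyC0.
pose lam (i : 'I_n.+1) : K := (i == ord_max)%:R.
have lam0 : lam ord_max != 0 by rewrite /lam eqxx oner_neq0.
have pn0 : mpoly_to_uni lam f != 0.
  apply: contra_neq fn0 => p0; rewrite -(mpoly_to_uniK lam0 f) p0.
  exact: (rmorph0 (uni_to_mpoly lam)).
move: (pn0); rewrite -lead_coef_eq0 => /IH [a an0].
have : map_poly (meval a) (mpoly_to_uni lam f) != 0.
  by apply: contraNneq an0 => p0; rewrite lead_coefE -coef_map p0 coef0.
move=> /closed_nonrootP [xi]; rewrite /root eval_mpoly_to_uni => h.
by eexists; exact: h.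
Qed.

Lemma coefM_top (A : comNzRingType) (p q : {poly A}) a b :
  (size p <= a.+1)%N -> (size q <= b.+1)%N ->
  (size (p * q)%R <= (a + b).+1)%N /\ (p * q)`_(a + b) = p`_a * q`_b.
Proof.
move=> sp sq; split.
  apply: leq_trans (size_polyMleq _ _) _.
  by move: sp sq; lia.
have oa : (a < (a + b).+1)%N by rewrite ltnS leq_addr.
rewrite coefM (bigD1 (Ordinal oa)) //= addKn big1 ?addr0 // => i ia.
have [ai|ia'] := ltnP a i; first by rewrite nth_default ?mul0r // (leq_trans sp).
have lta : (i < a)%N by rewrite ltn_neqAle ia' andbT; apply: contraNneq ia => E; apply/eqP/val_inj.
rewrite [q`__]nth_default ?mulr0 // (leq_trans sq) //.
by move: lta (ltn_ord i); lia.
Qed.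

Lemma mcoeff_pihomog (R : nzRingType) n (mf : measure n) d (p : {mpoly R[n]}) m :
  (pihomog mf d p)@_m = if mf m == d then p@_m else 0.
Proof.
rewrite /pihomog raddf_sum /= [in RHS](mpolyE p) raddf_sum big_mkcond /=.
case: ifP => md.
  apply: eq_bigr => m' _; case: ifP => // md'.
  by rewrite mcoeffZ mcoeffX; have [mm|_] := eqVneq m' m; rewrite ?mulr0 //; move: md'; rewrite mm md.
apply: big1 => m' _; case: ifP => // md'.
by rewrite mcoeffZ mcoeffX; have [mm|_] := eqVneq m' m; rewrite ?mulr0 //; move: md'; rewrite mm md.
Qed.

(** Only monomials of degree [d] reach X^d, and each factor x_i contributes [lam i] to that
    coefficient. *)
Lemma mpoly_to_uni_top (K : fieldType) n (lam : 'I_n.+1 -> K) (f : {mpoly K[n.+1]}) d :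
  (forall m, m \in msupp f -> (mdeg m <= d)%N) ->
  (size (mpoly_to_uni lam f) <= d.+1)%N /\
  (mpoly_to_uni lam f)`_d = (pihomog mdeg d f).@[lam]%:MP.
Proof.
move=> fd.
have mono m : (size (mpoly_to_uni lam 'X_[m]) <= (mdeg m).+1)%N /\
    (mpoly_to_uni lam 'X_[m])`_(mdeg m) = (\prod_i lam i ^+ m i)%:MP.
  rewrite /mpoly_to_uni mmapX /mmap1 mdegE.
  elim/big_rec3: _ => [|i p e q _ [sq cq]]; first by rewrite size_poly1 coefC mpolyC1.
  rewrite rmorphM /=.
  have [sq1 cq1] : (size ((insert0 ord_max (fun j => ('X_j)%:P) i + (lam i)%:MP *: 'X : {poly {mpoly K[n]}}) ^+ m i)%R <= (m i).+1)%N /\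
    ((insert0 ord_max (fun j => ('X_j)%:P) i + (lam i)%:MP *: 'X : {poly {mpoly K[n]}}) ^+ m i)`_(m i) = (lam i ^+ m i)%:MP.
    set l := (_ + _ : {poly _}).
    have sl : (size l <= 2)%N.
      apply: leq_trans (size_polyD _ _) _; rewrite geq_max; apply/andP; split.
        rewrite /insert0; case: unlift => [j|]; last by rewrite size_poly0.
        by rewrite size_polyC (leq_trans (leq_b1 _)).
      by apply: leq_trans (size_scale_leq _ _) _; rewrite size_polyX.
    have cl : l`_1 = (lam i)%:MP.
      rewrite coefD coefZ coefX mulr1 /insert0.
      by case: unlift => [j|]; rewrite ?coefC ?coef0 add0r.
    elim: (m i) => [|e' [s1 c1]]; first by rewrite !expr0 size_poly1 coefC mpolyC1.
    rewrite !exprS; have [s2 c2] := coefM_top sl s1; split => //.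
    by rewrite -[e'.+1]add1n c2 cl c1 mpolyCM.
  have [s3 c3] := coefM_top sq1 sq; split => //.
  by rewrite c3 cq1 cq.
rewrite /mpoly_to_uni in mono *.
rewrite [f in mmap _ _ f]mpolyE raddf_sum /=; split.
  apply: leq_trans (size_sum _ _ _) _; apply/bigmax_leqP_seq => m mf _.
  rewrite mmapZ /= mul_polyC; apply: leq_trans (size_scale_leq _ _) _.
  by apply: leq_trans (mono m).1 _; rewrite ltnS fd.
rewrite coef_sum /pihomog (raddf_sum (meval lam)) (raddf_sum (@mpolyC n K)) [RHS]big_mkcond /=.
apply: eq_big_seq => m mf; rewrite mmapZ /= coefCM.
case: eqP => [<-|/eqP md]; first by rewrite (mono m).2 mevalZ mevalX mpolyCM.
rewrite nth_default ?mulr0 //; apply: leq_trans (mono m).1 _.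
by rewrite ltn_neqAle md fd.
Qed.

(** Induction on [n]: a substitution makes some nonzero element of [I] monic in the last variable.
    The elimination ideal has a zero by induction, and [ideal_extend_zero] extends it. *)
Lemma weak_nullstellensatz (K : closedFieldType) (n : nat)
    (I : {mpoly K[n]} -> Prop) :
  is_ideal I -> ~ I 1 -> exists x, forall f, I f -> f.@[x] = 0.
Proof.
elim: n I => [|n IH] I idI I1; case: (idI) => I0 ID IM.
  exists (fun=> 0) => f If; rewrite (nvar0_mpolyC f) mevalC.
  apply/eqP/negPn/negP => c0; apply: I1.
  have -> : 1 = (f@_0%MM)^-1%:MP * f by rewrite {2}(nvar0_mpolyC f) -mpolyCM mulVf.
  exact: IM.
have [[f [If fn0]]|If0] := pselect (exists f, I f /\ f != 0); last first.
  exists (fun=> 0) => f If; have [->|fn0] := eqVneq f 0; first exact: meval0.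
  by case: If0; exists f.
pose d := (msize f).-1.
have fd m : m \in msupp f -> (mdeg m <= d)%N.
  by move=> /msize_mdeg_lt; rewrite /d; case: (msize f).
have topn0 : pihomog mdeg d f != 0.
  have mlf := mlead_supp fn0.
  have dE : mdeg (mlead f) = d by rewrite /d -(mlead_deg fn0).
  apply: contraTneq mlf => t0; rewrite mcoeff_msupp negbK.
  by have /= := mcoeff_pihomog mdeg d f (mlead f); rewrite dE eqxx t0 mcoeff0 => <-.
(* The extra factor makes one [lam] serve both purposes: the top form does not vanish there, and the
   substitution is invertible. *)
have [lam] : exists lam, (pihomog mdeg d f * 'X_ord_max).@[lam] != 0.
  by apply: mpoly_neq0_point; rewrite mulf_neq0 // -msize_poly_eq0 msizeX.
rewrite mevalM mevalXU mulf_eq0 negb_or => /andP[topl lam0].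
pose c := (pihomog mdeg d f).@[lam].
pose I' p := I (uni_to_mpoly lam p).
have idI' : is_ideal I'.
  split; first by rewrite /I' (rmorph0 (uni_to_mpoly lam)).
    by move=> p q Ip Iq; rewrite /I' (rmorphD (uni_to_mpoly lam)); apply: ID.
  by move=> a p Ip; rewrite /I' (rmorphM (uni_to_mpoly lam)); apply: IM.
have I'phi g : I g -> I' (mpoly_to_uni lam g) by rewrite /I' mpoly_to_uniK.
pose g := c^-1%:MP%:P * mpoly_to_uni lam f.
have gmon : g \is monic.
  have [sf cf] := mpoly_to_uni_top lam fd.
  have cg : g`_d = 1 by rewrite coefCM cf -mpolyCM mulVf // mpolyC1.
  have sg : size g = d.+1.
    apply/eqP; rewrite eqn_leq; apply/andP; split.
      by rewrite /g mul_polyC; apply: leq_trans (size_scale_leq _ _) _.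
    rewrite ltnNge; apply/negP => sg.
    by have /eqP := nth_default 0 sg; rewrite cg oner_eq0.
  by rewrite monicE lead_coefE sg cg.
have I'g : I' g by case: idI' => _ _; apply; apply: I'phi.
have [a Ia] : exists a, forall h, I' h%:P -> h.@[a] = 0.
  apply: IH; last by rewrite /I' polyC1 (rmorph1 (uni_to_mpoly lam)).
  case: idI' => J0 JD JM; split; first by rewrite polyC0.
    by move=> x y Ix Iy; rewrite polyCD; apply: JD.
  by move=> b x Ix; rewrite polyCM; apply: JM.
have [xi xiP] := @ideal_extend_zero K _ (meval a) (@mpolyC n K) I' g (mevalC a) idI' I'g gmon Ia.
eexists => h Ih; have := xiP _ (I'phi _ Ih).
by rewrite eval_mpoly_to_uni; exact.
Qed.

(** Brings two relations of the Rabinowitsch ideal to a common power of [g]. *)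
Lemma mulr_common_multiple (R : comNzRingType) (a b p q w r r' : R) :
  a * b * (p + q) - w * (b * r + a * r') =
  b * (a * p - w * r) + a * (b * q - w * r').
Proof. ring. Qed.

(* Rabinowitsch: the ideal J below is the kernel of K[x][y] -> (K[x]/I)_g,
   y |-> 1/g, which is everything exactly when g is nilpotent modulo I. *)
Lemma nullstellensatz (K : closedFieldType) (n : nat)
    (I : {mpoly K[n]} -> Prop) (g : {mpoly K[n]}) :
  is_ideal I -> (forall x, (forall f, I f -> f.@[x] = 0) -> g.@[x] = 0) ->
  exists s, I (g ^+ s).
Proof.
move=> [I0 ID IM] Ig.
pose IP (p : {poly {mpoly K[n]}}) := forall k, I p`_k.
have IPD p q : IP p -> IP q -> IP (p + q) by move=> Ip Iq k; rewrite coefD; apply: ID.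
have IPM a p : IP p -> IP (a * p).
  by move=> Ip k; rewrite coefM; apply: ideal_sum => // i _; apply: IM.
pose w : {poly {mpoly K[n]}} := 1 - g%:P * 'X.
pose J p := exists s r, IP (g%:P ^+ s * p - w * r).
pose lam (i : 'I_n.+1) : K := (i == ord_max)%:R.
have [Jphi1|Jphi1] := pselect (J 1).
  case: Jphi1 => s [r]; rewrite mulr1 => Jr.
  (* Comparing coefficients in g^s = (1 - g X) r modulo [I] gives r_k = g^(s + k) by recursion; at k
     = [size r] the left side is zero. *)
  have rk k : I (r`_k - g ^+ (s + k)).
    elim: k => [|k IHk].
      have := IM (-1) _ (Jr 0%N); rewrite mulN1r coefB -polyC_exp coefC eqxx /w.
      by rewrite mulrBl mul1r coefB -mulrA coefCM coefXM eqxx mulr0 subr0 opprB addn0.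
    have := ID _ _ (IM (-1) _ (Jr k.+1)) (IM g _ IHk).
    rewrite mulN1r coefB -polyC_exp coefC /= /w mulrBl mul1r coefB -mulrA coefCM coefXM /=.
    rewrite addnS exprS => h; rewrite [X in I X](_ : _ = - (0 - (r`_k.+1 - g * r`_k)) + g * (r`_k - g ^+ (s + k))) //.
    by ring.
  exists (s + size r)%N; have := IM (-1) _ (rk (size r)).
  by rewrite nth_default // sub0r mulN1r opprK.
have idJ : is_ideal (fun q => J (mpoly_to_uni lam q)).
  split.
  - exists 0%N, 0 => k; rewrite (rmorph0 (mpoly_to_uni lam)) !mulr0 subr0 coef0; exact: I0.
  - move=> p q [s [r hp]] [t [r' hq]]; exists (s + t)%N, (g%:P ^+ t * r + g%:P ^+ s * r').
    rewrite (rmorphD (mpoly_to_uni lam)).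
    set P := mpoly_to_uni lam p in hp *; set Q := mpoly_to_uni lam q in hq *.
    by rewrite exprD mulr_common_multiple; apply: IPD; apply: IPM.
  move=> a p [s [r hp]]; exists s, (mpoly_to_uni lam a * r).
  rewrite (rmorphM (mpoly_to_uni lam)).
  set P := mpoly_to_uni lam p in hp *; set Q := mpoly_to_uni lam a.
  by rewrite mulrCA [w * _]mulrCA -mulrBr; apply: IPM.
(* A zero of [J] consists of a zero [a] of [I] and an inverse of g(a), whereas g(a) = 0 by
   assumption. *)
have [|x xJ] := weak_nullstellensatz idJ; first by rewrite (rmorph1 (mpoly_to_uni lam)).
pose a j := x (lift ord_max j).
have evx q : q.@[x] = (map_poly (meval a) (mpoly_to_uni lam q)).[x ord_max].
  rewrite eval_mpoly_to_uni; apply: meval_eq => i; rewrite /insert0 /lam /a.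
  by case: unliftP => [j ->|->]; rewrite ?eqxx ?mul1r ?add0r // eq_sym eq_liftF mul0r addr0.
pose wid : {mpoly K[n]} -> {mpoly K[n.+1]} := mmap (@mpolyC n.+1 K) (fun j => 'X_(lift ord_max j)).
have phiw f : mpoly_to_uni lam (wid f) = f%:P.
  apply: (mpoly_rmorph_eq (g1 := mpoly_to_uni lam \o mmap (@mpolyC n.+1 K) (fun j => 'X_(lift ord_max j))) (g2 := @polyC _)) => [c|i] /=.
    by rewrite mmapC /mpoly_to_uni mmapC.
  rewrite mmapX mmap1U /mpoly_to_uni mmapX mmap1U /insert0 liftK /lam eq_sym eq_liftF.
  by rewrite mpolyC0 scale0r addr0.
have phiX : mpoly_to_uni lam 'X_ord_max = 'X.
  by rewrite /mpoly_to_uni mmapX mmap1U /insert0 unlift_none add0r /lam eqxx mpolyC1 scale1r.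
have ga : g.@[a] = 0.
  apply: Ig => f If; have := xJ (wid f); rewrite evx phiw map_polyC hornerC; apply.
  by exists 0%N, 0 => k; rewrite expr0 mul1r mulr0 subr0 coefC; case: ifP.
have := xJ (1 - wid g * 'X_ord_max); rewrite evx.
rewrite (rmorphB (mpoly_to_uni lam)) (rmorphM (mpoly_to_uni lam)) (rmorph1 (mpoly_to_uni lam)) /= phiw phiX.
rewrite rmorphB rmorph1 rmorphM /= map_polyC hornerD hornerN hornerM !hornerC /= ga mul0r subr0.
move=> h; suff /h/eqP : J (1 - g%:P * 'X) by rewrite oner_eq0.
by exists 0%N, 1 => k; rewrite expr0 mul1r mulr1 subrr coef0; exact: I0.
Qed.

(** * Weighted degrees and leading forms *)

Definition wdeg (n : nat) (w : 'I_n -> nat) (m : 'X_{1..n}) : nat :=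
  (\sum_(i < n) m i * w i)%N.

Lemma wdeg0 n (w : 'I_n -> nat) : wdeg w 0%MM = 0%N.
Proof. by rewrite /wdeg big1 // => i _; rewrite mnm0E. Qed.

Lemma wdegD n (w : 'I_n -> nat) :
  {morph wdeg w : m1 m2 / (m1 + m2)%MM >-> (m1 + m2)%N}.
Proof.
by move=> m1 m2; rewrite /wdeg -big_split; apply: eq_bigr => i _; rewrite mnmDE mulnDl.
Qed.

HB.instance Definition _ n (w : 'I_n -> nat) :=
  isMeasure.Build n (wdeg w) (wdeg0 w) (wdegD w).

Lemma wdegU n (w : 'I_n -> nat) i : wdeg w U_(i)%MM = w i.
Proof.
rewrite /wdeg (bigD1 i) //= mnm1E eqxx mul1n big1 ?addn0 // => j ji.
by rewrite mnm1E eq_sym (negPf ji).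
Qed.

Section DegreeSupport.
Variables (K : nzRingType) (n : nat) (mf : measure n).
Implicit Types (P : pred nat) (p q : {mpoly K[n]}).

(** A predicate rather than a bound: upper bounds, lower bounds and fixed degrees are then handled
    by the same closure lemmas. *)
Definition deg_in P p : Prop := forall m, p@_m != 0 -> P (mf m).

Lemma deg_in0 P : deg_in P 0.
Proof. by move=> m; rewrite mcoeff0 eqxx. Qed.

Lemma deg_inD P p q : deg_in P p -> deg_in P q -> deg_in P (p + q).
Proof.
move=> hp hq m; rewrite mcoeffD.
have [p0|/hp //] := eqVneq p@_m 0; have [q0|/hq //] := eqVneq q@_m 0.
by rewrite p0 q0 addr0 eqxx.
Qed.

Lemma deg_inZ P c p : deg_in P p -> deg_in P (c *: p).
Proof.
by move=> hp m; rewrite mcoeffZ; have [->|/hp //] := eqVneq p@_m 0; rewrite mulr0 eqxx.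
Qed.

Lemma deg_inN P p : deg_in P p -> deg_in P (- p).
Proof. by move=> hp; rewrite -scaleN1r; apply: deg_inZ. Qed.

Lemma deg_inB P p q : deg_in P p -> deg_in P q -> deg_in P (p - q).
Proof. by move=> hp hq; apply: deg_inD => //; apply: deg_inN. Qed.

Lemma deg_in_sum P (T : Type) (r : seq T) (Q : pred T) (F : T -> {mpoly K[n]}) :
  (forall i, Q i -> deg_in P (F i)) -> deg_in P (\sum_(i <- r | Q i) F i).
Proof. by move=> hF; elim/big_ind: _ => //; [apply: deg_in0 | apply: deg_inD]. Qed.

Lemma deg_inW P P' p : (forall d, P d -> P' d) -> deg_in P p -> deg_in P' p.
Proof. by move=> PP' hp m /hp /PP'. Qed.

Lemma deg_inX P m : P (mf m) -> deg_in P 'X_[m].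
Proof. by move=> Pm m'; rewrite mcoeffX; have [<-//|_] := eqVneq m m'; rewrite eqxx. Qed.

Lemma deg_in_homog d P p : P d -> p \is d.-homog for mf -> deg_in P p.
Proof. by move=> Pd /dhomogP hp m; rewrite -mcoeff_msupp => /hp ->. Qed.

Lemma deg_inM (P1 P2 P : pred nat) p q :
  (forall a b, P1 a -> P2 b -> P (a + b)%N) ->
  deg_in P1 p -> deg_in P2 q -> deg_in P (p * q).
Proof.
move=> PP hp hq; rewrite mpolyME; apply: deg_in_sum => -[m1 m2] _ /=.
have [z|p0] := eqVneq p@_m1 0; first by rewrite z mul0r scale0r; apply: deg_in0.
have [z|q0] := eqVneq q@_m2 0; first by rewrite z mulr0 scale0r; apply: deg_in0.
by apply/deg_inZ/deg_inX; rewrite mfD; apply: PP; [apply: hp | apply: hq].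
Qed.

Lemma deg_in_C P c : P 0%N -> deg_in P c%:MP.
Proof.
move=> P0; rewrite -[c]mulr1 mpolyCM mul_mpolyC mpolyC1 -mpolyX0.
by apply/deg_inZ/deg_inX; rewrite mf0.
Qed.

Lemma deg_in_bounded p : exists d, deg_in (fun e => e <= d)%N p.
Proof.
by exists (mmeasure mf p) => m; rewrite -mcoeff_msupp => /mmeasure_mnm_lt/ltnW.
Qed.

End DegreeSupport.

(** With [ltn] for [cmp] this describes a top form, with the reversed order a lowest form. The form
    [ft] may be zero. *)
Definition has_lead (K : nzRingType) (n : nat) (mf : measure n) (cmp : rel nat)
    (e : nat) (f ft : {mpoly K[n]}) : Prop :=
  ft \is e.-homog for mf /\ deg_in mf (cmp^~ e) (f - ft).

Definition in_ideal_of (A : comNzRingType) (T : finType) (f : T -> A) (p : A) : Prop :=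
  exists a : T -> A, p = \sum_j a j * f j.

Lemma is_ideal_of (A : comNzRingType) (T : finType) (f : T -> A) :
  is_ideal (in_ideal_of f).
Proof.
split; first by exists (fun=> 0); rewrite big1 // => j _; rewrite mul0r.
  move=> p q [a ->] [b ->]; exists (fun j => a j + b j).
  by rewrite -big_split; apply: eq_bigr => j _; rewrite mulrDl.
move=> c p [a ->]; exists (fun j => c * a j).
by rewrite mulr_sumr; apply: eq_bigr => j _; rewrite mulrA.
Qed.

Lemma in_ideal_gen (A : comNzRingType) (T : finType) (f : T -> A) j : in_ideal_of f (f j).
Proof.
exists (fun i => (i == j)%:R); rewrite (bigD1 j) //= eqxx mul1r big1 ?addr0 //.
by move=> i /negPf ->; rewrite mul0r.
Qed.

(** By the Nullstellensatz a power of each variable lies in the ideal, and a monomial of large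
    degree is divisible by one of these powers. *)
Lemma origin_only_zero_nilpotent (K : closedFieldType) (n : nat) (T : finType)
    (f : T -> {mpoly K[n]}) :
  (forall x, (forall j, (f j).@[x] = 0) -> forall i, x i = 0) ->
  exists s, forall m, (s <= mdeg m)%N -> in_ideal_of f 'X_[m].
Proof.
move=> fx; have idI := is_ideal_of f; case: (idI) => _ _ IM.
have /choice [s sP] (i : 'I_n) : exists s, in_ideal_of f ('X_i ^+ s).
  apply: nullstellensatz => // x xI; rewrite mevalXU; apply: fx => j.
  exact/xI/in_ideal_gen.
exists (\sum_i s i).+1 => m hm.
have [i smi] : exists i, (s i <= m i)%N.
  apply/existsP; apply: contraLR hm; rewrite negb_exists => /forallP h.
  rewrite -ltnNge ltnS mdegE; apply: leq_sum => i _.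
  by have := h i; rewrite -ltnNge => /ltnW.
have -> : m = (m - U_(i) *+ s i + U_(i) *+ s i)%MM.
  rewrite submK //; apply/mnm_lepP => k; rewrite mulmnE mnm1E.
  by case: eqP => [<-|]; rewrite ?mul1n.
by rewrite mpolyXD -mpolyXn; apply: IM.
Qed.

Lemma pihomogM (K : nzRingType) n (mf : measure n) d e (a g : {mpoly K[n]}) :
  g \is e.-homog for mf ->
  pihomog mf d (a * g) = (if (e <= d)%N then pihomog mf (d - e) a else 0) * g.
Proof.
move=> hg; rewrite [in LHS](mpolyE a) mulr_suml (raddf_sum (pihomog mf d)) /=.
have hX m : 'X_[m] * g \is (mf m + e).-homog for mf.
  by apply: dhomogM => //; rewrite dhomogX.
have step m : pihomog mf d (a@_m *: 'X_[m] * g) =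
    if mf m + e == d then a@_m *: 'X_[m] * g else 0.
  rewrite -scalerAl linearZ /=; case: eqP => [E|/eqP ne].
    by rewrite pihomog_dE // -E.
  by rewrite (pihomog_ne0 ne (hX m)) scaler0.
rewrite (eq_bigr _ (fun m _ => step m)).
case: leqP => ed; last first.
  by rewrite mul0r big1 // => m _; case: eqP => // E; move: ed; rewrite -E ltnNge leq_addl.
rewrite /pihomog mulr_suml [RHS]big_mkcond /=; apply: eq_bigr => m _.
by rewrite -(eqn_add2r e) subnK.
Qed.

(** Take the component of degree [d] of any relation expressing [p]. *)
Lemma in_ideal_homog (K : comNzRingType) n (mf : measure n) (T : finType)
    (g : T -> {mpoly K[n]}) (e : T -> nat) d p :
  (forall j, g j \is (e j).-homog for mf) -> p \is d.-homog for mf ->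
  in_ideal_of g p ->
  exists2 a : T -> {mpoly K[n]}, p = \sum_j a j * g j &
    forall j, ((e j <= d)%N -> a j \is (d - e j).-homog for mf) /\
              ((d < e j)%N -> a j = 0).
Proof.
move=> hg hp [a pE].
exists (fun j => if (e j <= d)%N then pihomog mf (d - e j) (a j) else 0).
  rewrite -(pihomog_dE hp) pE (raddf_sum (pihomog mf d)) /=.
  by apply: eq_bigr => j _; apply: pihomogM.
by move=> j; case: leqP => // _; split=> // _; apply: pihomogP.
Qed.

(** * Modules over K[f], filtered by the weight of the coefficients *)

Section FilteredSpan.
Variables (K : fieldType) (n k : nat) (B : finType).
Variables (f : k.-tuple {mpoly K[n]}) (b : B -> {mpoly K[n]}) (e : 'I_k -> nat).
Implicit Types (P : pred nat) (h : {mpoly K[n]}).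

(** The coefficients are kept as polynomials in [k] new variables, the j-th of weight [e j]: the
    filtration lives on them, and the [f_j] may be algebraically dependent. *)
Definition span_in P h : Prop :=
  exists2 q : B -> {mpoly K[k]}, h = \sum_i (q i \mPo f) * b i &
    forall i, deg_in (wdeg e) P (q i).

Lemma span_in0 P : span_in P 0.
Proof.
exists (fun=> 0) => [|i]; last exact: deg_in0.
by rewrite big1 // => i _; rewrite comp_mpoly0 mul0r.
Qed.

Lemma span_inD P h1 h2 : span_in P h1 -> span_in P h2 -> span_in P (h1 + h2).
Proof.
move=> [q1 -> h1q] [q2 -> h2q]; exists (fun i => q1 i + q2 i) => [|i].
  by rewrite -big_split; apply: eq_bigr => i _; rewrite comp_mpolyD mulrDl.
exact: deg_inD.
Qed.

Lemma span_in_sum P (T : Type) (r : seq T) (Q : pred T) (F : T -> {mpoly K[n]}) :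
  (forall i, Q i -> span_in P (F i)) -> span_in P (\sum_(i <- r | Q i) F i).
Proof. by move=> hF; elim/big_ind: _ => //; [apply: span_in0 | apply: span_inD]. Qed.

Lemma span_inZ P c h : span_in P h -> span_in P (c *: h).
Proof.
move=> [q -> hq]; exists (fun i => c *: q i) => [|i]; last exact: deg_inZ.
by rewrite scaler_sumr; apply: eq_bigr => i _; rewrite comp_mpolyZ scalerAl.
Qed.

Lemma span_inB P h1 h2 : span_in P h1 -> span_in P h2 -> span_in P (h1 - h2).
Proof. by move=> ? ?; rewrite -scaleN1r; apply: span_inD => //; apply: span_inZ. Qed.

Lemma span_inW P P' h : (forall d, P d -> P' d) -> span_in P h -> span_in P' h.
Proof. by move=> PP' [q -> hq]; exists q => // i; apply: deg_inW PP' (hq i). Qed.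

Lemma span_in_gen P i : P 0%N -> span_in P (b i).
Proof.
move=> P0; exists (fun j => (j == i)%:R) => [|j].
  rewrite (bigD1 i) //= eqxx comp_mpoly1 mul1r big1 ?addr0 //.
  by move=> j /negPf ->; rewrite comp_mpoly0 mul0r.
by case: (j == i); [rewrite -mpolyC1; apply: deg_in_C | apply: deg_in0].
Qed.

Lemma span_in_mulf P P' j h : (forall d, P d -> P' (d + e j)%N) ->
  span_in P h -> span_in P' (tnth f j * h).
Proof.
move=> PP' [q -> hq]; exists (fun i => q i * 'X_j) => [|i].
  rewrite mulr_sumr; apply: eq_bigr => i _.
  by rewrite rmorphM /= /comp_mpoly mmapX mmap1U mulrA [tnth f j * _]mulrC.
apply: (deg_inM (P2 := pred1 (e j))) (hq i) _.
  by move=> a c Pa /eqP ->; apply: PP'.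
by apply: deg_inX; rewrite /= wdegU.
Qed.

(** Expanding [r * b i] again in the generators adds an uncontrolled weight, so only conditions
    stable under increase, such as lower bounds, survive. *)
Lemma span_in_mul P r h : (forall h', span_in predT h') ->
  (forall a c, P a -> P (a + c)%N) -> span_in P h -> span_in P (r * h).
Proof.
move=> gens PP [q -> hq].
have /choice [p pP] (i : B) : exists p : B -> {mpoly K[k]}, r * b i = \sum_l (p l \mPo f) * b l.
  by have [p] := gens (r * b i); exists p.
exists (fun l => \sum_i q i * p i l) => [|l].
  rewrite mulr_sumr; under eq_bigr => i _ do rewrite mulrCA pP mulr_sumr.
  rewrite exchange_big; apply: eq_bigr => l _ /=.
  by rewrite rmorph_sum mulr_suml; apply: eq_bigr => i _; rewrite rmorphM mulrA.
apply: deg_in_sum => i _; apply: (deg_inM (P2 := predT)) (hq i) _ => //.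
by move=> a c Pa _; apply: PP.
Qed.

Lemma span_in_monomials P h :
  (forall m, h@_m != 0 -> span_in P 'X_[m]) -> span_in P h.
Proof.
move=> hX; rewrite [h]mpolyE big_seq; apply: span_in_sum => m.
by rewrite mcoeff_msupp => /hX; apply: span_inZ.
Qed.

End FilteredSpan.

(** The common rewriting step for top and lowest forms: replacing [ft_j] by [f_j] in an expression
    of a monomial leaves errors of strictly smaller, respectively larger, degree. *)
Lemma lead_expand (K : fieldType) n (mf : measure n) cmp k
    (f ft : k.-tuple {mpoly K[n]}) (e : 'I_k -> nat) m :
  (forall j, has_lead mf cmp (e j) (tnth f j) (tnth ft j)) ->
  in_ideal_of (tnth ft) 'X_[m] ->
  exists a : 'I_k -> {mpoly K[n]},
    'X_[m] = \sum_j (tnth f j * a j - a j * (tnth f j - tnth ft j)) /\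
    forall j, ((e j <= mf m)%N -> a j \is (mf m - e j).-homog for mf) /\
              ((mf m < e j)%N -> a j = 0).
Proof.
move=> fl; have h0 j : tnth ft j \is (e j).-homog for mf by case: (fl j).
have hm : ('X_[m] : {mpoly K[n]}) \is (mf m).-homog for mf by rewrite dhomogX.
case/(in_ideal_homog h0 hm) => a aE ha; exists a; split => //.
rewrite {1}aE; apply: eq_bigr => j _.
by rewrite mulrBr opprB [tnth f j * _]mulrC [RHS]addrC subrK.
Qed.

(** Induction on the degree bound: a monomial of high degree is expanded in the [f_j], and both the
    coefficients and the errors have smaller degree. The finitely many other monomials are the
    generators. *)
Lemma span_in_top (K : fieldType) n (mf : measure n) k
    (f ft : k.-tuple {mpoly K[n]}) (e : 'I_k -> nat) s :
  (forall j, 0 < e j)%N ->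
  (forall j, has_lead mf ltn (e j) (tnth f j) (tnth ft j)) ->
  (forall m, (s <= mdeg m)%N -> in_ideal_of (tnth ft) 'X_[m]) ->
  forall T h, deg_in mf (fun d => d <= T)%N h ->
    span_in f (fun m : 'X_{1..n < s} => 'X_[m]) e (fun d => d <= T)%N h.
Proof.
move=> e0 fl fts; elim/ltn_ind => T IH h hT; apply: span_in_monomials => m /hT mT.
case: (ltnP (mdeg m) s) => [ms|/fts ms].
  exact: (span_in_gen f (fun m : 'X_{1..n < s} => 'X_[m]) e (BMultinom ms)).
have [a [-> ha]] := lead_expand fl ms.
apply: span_in_sum => j _; have [h1 h2] := ha j.
case: (leqP (e j) (mf m)) => [ej|/h2 ->]; last by rewrite mulr0 mul0r subrr; apply: span_in0.
have [ej0 aj] := (e0 j, h1 ej).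
apply: span_inB.
  apply: (span_in_mulf (P := fun d => (d <= mf m - e j)%N)); first by move=> d; lia.
  apply: IH; first lia.
  by apply: deg_in_homog aj; rewrite leqnn.
apply: (span_inW (P := fun d => (d <= (mf m).-1)%N)); first by move=> d; lia.
apply: IH; first lia.
apply: (deg_inM (P1 := pred1 (mf m - e j)%N) (P2 := ltn^~ (e j))).
- by move=> x y /eqP -> /=; lia.
- by apply: deg_in_homog aj => /=.
- by case: (fl j).
Qed.

Lemma submonomial n (m : 'X_{1..n}) t : (t <= mdeg m)%N ->
  exists2 m1 : 'X_{1..n}, (m1 <= m)%MM & mdeg m1 = t.
Proof.
elim: t => [_|t IH tm]; first by exists 0%MM; rewrite ?mdeg0 //; apply/mnm_lepP => i; rewrite mnm0E.
have [m1 m1m m1t] := IH (ltnW tm).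
have [i mi] : exists i, (m1 i < m i)%N.
  apply/existsP; apply: contraLR tm; rewrite negb_exists => /forallP h.
  rewrite -leqNgt -m1t !mdegE; apply: leq_sum => i _.
  by have := h i; rewrite -leqNgt.
exists (m1 + U_(i))%MM; last by rewrite mdegD mdeg1 m1t addn1.
apply/mnm_lepP => j; rewrite mnmDE mnm1E.
case: eqP => [<-|_]; first by rewrite addn1.
by rewrite addn0; move/mnm_lepP: m1m.
Qed.

(** Rewriting through lowest forms pushes the errors to ever higher order and would not stop by
    itself. It may stop at order s' T, since such a monomial contains [T] factors in the ideal of
    the [f_j], each of which contributes weight at least 1. *)
Lemma span_in_low (K : fieldType) n k (B : finType)
    (f ft : k.-tuple {mpoly K[n]}) (b : B -> {mpoly K[n]}) (e : 'I_k -> nat) s s' :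
  (forall j, 0 < e j)%N ->
  (forall h, span_in f b e predT h) ->
  (forall j, has_lead (@mdeg n : measure n) (fun x y => y < x)%N (e j) (tnth f j) (tnth ft j)) ->
  (forall m, (s' <= mdeg m)%N -> in_ideal_of (tnth f) 'X_[m]) ->
  (forall m, (s <= mdeg m)%N -> in_ideal_of (tnth ft) 'X_[m]) ->
  forall T h, deg_in (@mdeg n : measure n) (fun d => T + s <= d)%N h ->
    span_in f b e (fun d => T <= d)%N h.
Proof.
move=> e0 gens fl fs fts.
have pow T m : (s' * T <= mdeg m)%N -> span_in f b e (fun d => T <= d)%N 'X_[m].
  elim: T m => [|T IH] m hm; first exact: span_inW (gens _).
  have [m1 m1m m1s] : exists2 m1 : 'X_{1..n}, (m1 <= m)%MM & mdeg m1 = s'.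
    by apply: submonomial; move: hm; rewrite mulnS; apply: leq_trans; rewrite leq_addr.
  have mE : m = (m - m1 + m1)%MM by rewrite submK.
  have [|a aE] := fs m1; first by rewrite m1s.
  rewrite mE mpolyXD aE mulr_sumr; apply: span_in_sum => j _.
  rewrite mulrA mulrC; apply: (span_in_mulf (P := fun d => T <= d)%N).
    by move=> d; have := e0 j; lia.
  rewrite mulrC; apply: span_in_mul => //; first by move=> x c; lia.
  apply: IH; move: hm; rewrite {1}mE mdegD m1s mulnS; lia.
elim/ltn_ind => T IHT h hT.
(* Here [u] bounds the remaining distance to the order s' T. *)
suff down u h' : deg_in (@mdeg n : measure n) (fun d => (T + s <= d) && (s' * T <= d + u))%N h' ->
    span_in f b e (fun d => T <= d)%N h'.
  apply: (down (s' * T)%N); apply: deg_inW hT => d ->; rewrite leq_addl //.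
elim: u h' => [|u IHu] h' hh'; apply: span_in_monomials => m /hh' /= /andP[Tm um].
  by apply: pow; rewrite -[mdeg m]addn0.
have [|a [-> ha]] := lead_expand fl (m := m); first by apply: fts; lia.
apply: span_in_sum => j _; have [/= h1 h2] := ha j.
case: (leqP (e j) (mdeg m)) => [ej|/h2 ->]; last by rewrite mulr0 mul0r subrr; apply: span_in0.
have [ej0 aj] := (e0 j, h1 ej).
apply: span_inB; last first.
  apply: IHu; apply: (deg_inM (P1 := pred1 (mdeg m - e j)%N) (P2 := fun x => e j < x)%N).
  - by move=> x y /eqP -> /=; lia.
  - by apply: deg_in_homog aj => /=.
  - by case: (fl j).
(* The factor [f_j] already has weight [e j]; since [a j] has order at least T - e j + s, induction
   provides the rest. *)
case: (leqP (e j) T) => eT.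
  apply: (span_in_mulf (P := fun d => (T - e j <= d)%N)); first by move=> d; lia.
  apply: IHT; first lia.
  by apply: deg_in_homog aj; lia.
by apply: (span_in_mulf (P := predT)) (gens _) => d _; lia.
Qed.

(** * Rank of a polynomial ring over a subalgebra *)

Lemma card_inj_le (T T' : finType) (A : {set T}) (B : {set T'}) (f : T -> T') :
  {in A &, injective f} -> (forall x, x \in A -> f x \in B) -> (#|A| <= #|B|)%N.
Proof.
move=> finj fAB; rewrite -(card_in_imset finj); apply: subset_leq_card.
by apply/fintype.subsetP => _ /imsetP[x xA ->]; apply: fAB.
Qed.

(** * Counting monomials of bounded weight *)

Section CountMonomials.
Variable k : nat.
Implicit Types (e : 'I_k -> nat) (T : nat).

(** For positive weights the weight bounds the degree, so every monomial of weight at most [T]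
    occurs in this finite ambient type. *)
Definition wmon e T : {set 'X_{1..k < T.+1}} := [set m : 'X_{1..k < T.+1} | wdeg e m <= T]%N.

Lemma mdeg_le_wdeg e (m : 'X_{1..k}) : (forall j, 0 < e j)%N -> (mdeg m <= wdeg e m)%N.
Proof. by move=> e0; rewrite mdegE; apply: leq_sum => j _; apply: leq_pmulr. Qed.

Lemma card_wmon1 T : #|wmon (fun=> 1%N) T| = 'C(T + k, k).
Proof.
rewrite addnC -card_partial_ord_partitions; apply/eqP; rewrite eqn_leq; apply/andP; split.
  pose g (m : 'X_{1..k}) : k.-tuple 'I_T.+1 := [tuple inord (m j) | j < k].
  have mT (m : 'X_{1..k < T.+1}) j : (m j < T.+1)%N.
    by rewrite (leq_ltn_trans _ (bmdeg m)) // mdegE (bigD1 j) //= leq_addr.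
  apply: (card_inj_le (f := fun m : 'X_{1..k < T.+1} => g m)) => [m1 m2 _ _ E|m].
    apply/val_inj/mnmP => j; have := congr1 (fun t => val (tnth t j)) E.
    by rewrite /= !tnth_mktuple !inordK.
  rewrite !inE => _; rewrite big_tuple.
  under eq_bigr => j _ do rewrite tnth_mktuple inordK //.
  by rewrite -mdegE -ltnS bmdeg.
pose g (t : k.-tuple 'I_T.+1) : 'X_{1..k} := [multinom (tnth t j : nat) | j < k].
have gT (t : k.-tuple 'I_T.+1) : (\sum_(i <- t) i <= T)%N -> (mdeg (g t) <= T)%N.
  by rewrite big_tuple mdegE; under [X in _ -> (X <= _)%N]eq_bigr => j _ do rewrite mnmE.
have gv (t : k.-tuple 'I_T.+1) : (\sum_(i <- t) i <= T)%N -> val (insubd (@bm0 k T) (g t)) = g t.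
  by move=> tT; rewrite val_insubd ltnS gT.
apply: (card_inj_le (f := fun t => insubd (@bm0 k T) (g t))) => [t1 t2|t].
  rewrite !inE => h1 h2 /(congr1 val); rewrite !gv // => E.
  apply: eq_from_tnth => j; apply/val_inj.
  by have := congr1 (fun m : 'X_{1..k} => m j) E; rewrite !mnmE.
rewrite !inE => h; rewrite gv // /wdeg; under eq_bigr => j _ do rewrite muln1.
by rewrite -mdegE gT.
Qed.

Let scale_down e (m : 'X_{1..k}) : 'X_{1..k} := [multinom (m j %/ e j)%N | j < k].

(** Dividing each exponent by [e j] injects the monomials of degree at most [T] into pairs of a
    monomial of weight at most [T] and a vector of remainders. *)
Lemma card_wmon_ge e T : (forall j, 0 < e j)%N ->
  ('C(T + k, k) <= \prod_j e j * #|wmon e T|)%N.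
Proof.
move=> e0; rewrite -card_wmon1 mulnC.
pose fp (m : 'X_{1..k}) : fprod (fun j => 'I_(e j)) :=
  [fprod j => Ordinal (ltn_pmod (m j) (e0 j))].
pose g (m : 'X_{1..k < T.+1}) := (insubd (@bm0 k T) (scale_down e m), fp m).
have -> : (\prod_j e j)%N = #|[set: fprod (fun j => 'I_(e j))]|.
  by rewrite cardsT card_fprod; apply: eq_bigr => j _; rewrite card_ord.
have wd m : (wdeg e (scale_down e m) <= mdeg m)%N.
  by rewrite mdegE; apply: leq_sum => j _; rewrite mnmE leq_trunc_div.
have gv m : m \in wmon (fun=> 1%N) T -> val (insubd (@bm0 k T) (scale_down e m)) = scale_down e m.
  move=> _; rewrite val_insubd ltnS.
  have -> // : (mdeg (scale_down e m) <= T)%N.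
  by rewrite (leq_trans (mdeg_le_wdeg _ e0)) // (leq_trans (wd _)) // -ltnS bmdeg.
rewrite -cardsX; apply: (card_inj_le (f := g)) => [m1 m2 h1 h2 E|m hm].
  have E1 := congr1 fst E; have E2 := congr1 snd E; rewrite /= in E1 E2.
  apply/val_inj/mnmP => j.
  have := congr1 (fun m : 'X_{1..k < T.+1} => (m : 'X_{1..k}) j) E1.
  rewrite !gv // !mnmE => d12.
  have := congr1 (fun u : fprod (fun j => 'I_(e j)) => val (u j)) E2; rewrite !fprodE /= => r12.
  by rewrite (divn_eq (m1 j) (e j)) d12 r12 -divn_eq.
rewrite !inE /= ?andbT gv // (leq_trans (wd _)) //.
by rewrite -ltnS bmdeg.
Qed.

(** The reverse of the division with remainder; the remainders raise the degree by at most the sum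
    of the [e j]. *)
Lemma card_wmon_le e T : (forall j, 0 < e j)%N ->
  (\prod_j e j * #|wmon e T| <= 'C(T + \sum_j e j + k, k))%N.
Proof.
move=> e0; rewrite -card_wmon1 mulnC.
have -> : (\prod_j e j)%N = #|[set: fprod (fun j => 'I_(e j))]|.
  by rewrite cardsT card_fprod; apply: eq_bigr => j _; rewrite card_ord.
pose up (m : 'X_{1..k}) (r : fprod (fun j => 'I_(e j))) : 'X_{1..k} :=
  [multinom (m j * e j + r j)%N | j < k].
pose U := (T + \sum_j e j)%N.
have upd m r : (wdeg e m <= T)%N -> (mdeg (up m r) <= U)%N.
  move=> mT; rewrite mdegE; under eq_bigr => j _ do rewrite mnmE.
  by rewrite big_split leq_add //; apply: leq_sum => j _; apply: ltnW.
have gv (m : 'X_{1..k}) r : (wdeg e m <= T)%N -> val (insubd (@bm0 k U) (up m r)) = up m r.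
  by move=> mT; rewrite val_insubd ltnS upd.
rewrite -cardsX.
apply: (card_inj_le (f := fun mr : 'X_{1..k < T.+1} * _ => insubd (@bm0 k U) (up mr.1 mr.2))) => [[m1 r1] [m2 r2]|[m r]].
  rewrite !inE /= !andbT => h1 h2 /(congr1 val); rewrite !gv // => E.
  have Ej j : m1 j = m2 j /\ r1 j = r2 j.
    have /= := congr1 (fun u : 'X_{1..k} => u j) E; rewrite !mnmE => Ej.
    have := congr1 (divn^~ (e j)) Ej; rewrite /= !divnMDl // !divn_small // !addn0 => md.
    by split => //; apply/val_inj/eqP; rewrite -(eqn_add2l (m1 j * e j)) Ej md.
  congr (_, _); first by apply/val_inj/mnmP => j; case: (Ej j).
  by apply/fprodP => j; case: (Ej j).
rewrite !inE /= andbT => h; rewrite gv //.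
have -> : wdeg (fun=> 1%N) (up m r) = mdeg (up m r) by rewrite mdegE; apply: eq_bigr => j _; rewrite muln1.
exact: upd.
Qed.

End CountMonomials.

Lemma leq_expl m n k : (m <= n)%N -> (m ^ k <= n ^ k)%N.
Proof. by move=> mn; elim: k => // k IH; rewrite !expnS leq_mul. Qed.

(* C(T+k, k) is a polynomial in T of degree k, so shifting T does not change
   its leading behaviour. *)
Lemma binomial_shift_le a b k h :
  (forall T, a * 'C(T + k, k) <= b * 'C(T + h + k, k))%N -> (a <= b)%N.
Proof.
move=> ab; rewrite leqNgt; apply/negP => ba.
have lo T : ((T + 1) ^ k <= 'C(T + k, k) * k`!)%N.
  rewrite bin_ffact; elim: k {ab} => // k IH.
  rewrite addn1 addnS ffactSS expnS; apply: leq_mul; first by rewrite ltnS leq_addr.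
  by rewrite -addn1.
have up T : ('C(T + k, k) * k`! <= (T + k) ^ k)%N.
  rewrite bin_ffact; elim: k {ab lo} => // k IH.
  rewrite addnS ffactSS expnS; apply: leq_mul => //.
  by apply: leq_trans IH _; apply: leq_expl.
(* The estimate (x + H)^k - x^k <= k H (x + H)^(k-1), multiplied by x + H and written without
   subtraction. *)
have bern x H : ((x + H) ^ k.+1 <= x ^ k * (x + H) + k * H * (x + H) ^ k)%N.
  elim: k {ab lo up} => [|k IH]; first by rewrite !expn0 expn1 mul1n mul0n addn0.
  rewrite [X in (X <= _)%N]expnS mulnDl.
  apply: (@leq_trans (x * (x ^ k * (x + H) + k * H * (x + H) ^ k) + H * (x + H) ^ k.+1)).
    by rewrite leq_add2r leq_mul2l IH orbT.
  have f1 : (x * (x + H) ^ k <= (x + H) ^ k.+1)%N by rewrite expnS leq_mul2r leq_addr orbT.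
  have := leq_mul (leqnn (k * H)%N) f1.
  rewrite [(x ^ k.+1)%N]expnS; move: (x ^ k)%N ((x + H) ^ k)%N ((x + H) ^ k.+1)%N => Y X Z.
  lia.
pose H := (h + k)%N.
(* If a > b, the bounds give (b + 1) x^k <= b (x + H)^k; with [bern] this forces x <= (b + 1) k
   H. *)
pose x := (b.+1 * (k * H)).+1.
have E1 : (b.+1 * x ^ k <= b * (x + H) ^ k)%N.
  have E := leq_mul (ab x.-1) (leqnn k`!); rewrite -!mulnA in E.
  have lo1 : (x ^ k <= 'C(x.-1 + k, k) * k`!)%N by have := lo x.-1; rewrite addn1.
  have up1 : ('C(x.-1 + h + k, k) * k`! <= (x + H) ^ k)%N.
    by apply: leq_trans (up _) _; apply: leq_expl; rewrite /H; lia.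
  apply: leq_trans (leq_mul ba lo1) (leq_trans E _).
  by rewrite leq_mul2l up1 orbT.
have E2 := leq_mul (leqnn b.+1) (bern x H).
have E3 := leq_mul E1 (leqnn (x + H)%N).
have X0 : (0 < (x + H) ^ k)%N by rewrite expn_gt0.
have E4 : (x * (x + H) ^ k <= (x + H) ^ k.+1)%N by rewrite expnS leq_mul2r leq_addr orbT.
have EX : ((x + H) ^ k.+1 = (x + H) ^ k * (x + H))%N by rewrite expnS mulnC.
clear E1; have xE : x = (b.+1 * (k * H)).+1 by [].
move: E2 E3 X0 E4; rewrite EX; move: ((x + H) ^ k)%N (x ^ k)%N => X Y.
move: (x + H)%N => S; rewrite xE; move: (k * H)%N => Z.
lia.
Qed.

Section Pigeonhole.
Variable K : fieldType.

Lemma lin_dep (D B : finType) (phi : D -> B -> K) : (#|B| < #|D|)%N ->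
  exists2 c : D -> K, (exists d, c d != 0) & forall i, \sum_d c d * phi d i = 0.
Proof.
move=> BD; pose A : 'M[K]_(#|D|, #|B|) := \matrix_(i, j) phi (enum_val i) (enum_val j).
have : kermx A != 0.
  rewrite kermx_eq0 /row_free neq_ltn; apply/orP; left.
  exact: leq_ltn_trans (rank_leq_col A) BD.
case/rowV0Pn => u /sub_kermxP uA un0.
exists (fun d => u 0 (enum_rank d)).
  apply: contrapT => h; case/eqP: un0; apply/rowP => j; rewrite mxE.
  apply/eqP/negPn/negP => uj; apply: h; exists (enum_val j).
  by rewrite enum_valK.
move=> i; have := congr1 (fun M : 'rV_#|B| => M 0 (enum_rank i)) uA.
rewrite !mxE => E; rewrite -[RHS]E (reindex (fun j : 'I_#|D| => enum_val j)) /=; last first.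
  exact/onW_bij/enum_val_bij.
apply: eq_bigr => j _.
by rewrite mxE !enum_rankK enum_valK.
Qed.

End Pigeonhole.

(** The vectors of polynomials live in a space with one coordinate for each index in [I] and each
    monomial of weight at most [T]. *)
Lemma mpoly_lin_dep (K : fieldType) k (e : 'I_k -> nat) T (D I : finType)
    (phi : D -> I -> {mpoly K[k]}) :
  (forall j, 0 < e j)%N ->
  (forall d i, deg_in (wdeg e) (fun x => x <= T)%N (phi d i)) ->
  (#|I| * #|wmon e T| < #|D|)%N ->
  exists2 c : D -> K, (exists d, c d != 0) & forall i, \sum_d c d *: phi d i = 0.
Proof.
move=> e0 phiT ID.
have [|c cn0 c0] := @lin_dep K D (I * 'I_#|wmon e T|)%type
    (fun d ir => (phi d ir.1)@_(enum_val ir.2)).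
  by rewrite card_prod card_ord.
exists c => // i; apply/mpolyP => m; rewrite mcoeff0 raddf_sum /=.
case: (leqP (wdeg e m) T) => mT; last first.
  apply: big1 => d _; rewrite mcoeffZ.
  have [->|/phiT] := eqVneq (phi d i)@_m 0; first by rewrite mulr0.
  by rewrite leqNgt mT.
have mm : (mdeg m < T.+1)%N by rewrite ltnS (leq_trans (mdeg_le_wdeg _ e0)).
have mw : BMultinom mm \in wmon e T by rewrite inE.
rewrite -[RHS](c0 (i, enum_rank_in mw (BMultinom mm))) /=.
by apply: eq_bigr => d _; rewrite mcoeffZ enum_rankK_in.
Qed.

Lemma monomials_free (K : fieldType) k b (A : {set 'X_{1..k < b}}) (c : 'I_#|A| -> K) :
  \sum_r c r *: 'X_[enum_val r] = 0 :> {mpoly K[k]} -> forall r, c r = 0.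
Proof.
move=> c0 r; have := congr1 (mcoeff (enum_val r)) c0.
rewrite mcoeff0 raddf_sum /= (bigD1 r) //= mcoeffZ mcoeffX eqxx mulr1.
rewrite big1 ?addr0 // => r' r'r; rewrite mcoeffZ mcoeffX.
suff /negPf -> : (enum_val r' : 'X_{1..k}) != enum_val r by rewrite mulr0.
by apply: contraNneq r'r => /val_inj/enum_val_inj ->.
Qed.

(** * Independence over K[f] and bounds for the rank *)

Section Independence.
Variables (K : fieldType) (n k : nat) (B : finType).
Variables (f : k.-tuple {mpoly K[n]}) (b : B -> {mpoly K[n]}).

(** For nonempty [G] this also forces the [f_j] to be algebraically independent. *)
Definition indep (G : {set B}) : Prop :=
  forall q : B -> {mpoly K[k]}, \sum_(i in G) (q i \mPo f) * b i = 0 ->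
  forall i, i \in G -> q i = 0.

Lemma indep0 : indep finset.set0.
Proof. by move=> q _ i; rewrite inE. Qed.

(** By maximality each further [b i] has a relation with nonzero coefficient at [b i]; the product
    [Q] of these coefficients is a common denominator. So [G] plays the role of a basis over the
    fraction field. *)
Lemma max_indep (G0 : {set B}) : indep G0 ->
  exists G : {set B}, [/\ G0 \subset G, indep G &
  exists2 Q : {mpoly K[k]}, Q != 0 &
  exists p : B -> B -> {mpoly K[k]}, forall i,
    (Q \mPo f) * b i = \sum_(j in G) (p i j \mPo f) * b j].
Proof.
move=> iG0.
have [|G /maxsetP[/asboolP iG Gmax] G0G] := @maxset_exists _ (fun G => `[< indep G >]) G0.
  exact/asboolP.
exists G; split => //.
have /choice [Q /choice [p Qp]] (i : B) : exists Q : {mpoly K[k]}, exists p : B -> {mpoly K[k]},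
    Q != 0 /\ (Q \mPo f) * b i = \sum_(j in G) (p j \mPo f) * b j.
  have [iG'|iG'] := boolP (i \in G).
    exists 1, (fun j => (j == i)%:R); rewrite oner_neq0; split => //.
    rewrite (bigD1 i) //= eqxx big1 ?addr0 // => j /andP[_ /negPf ->].
    by rewrite comp_mpoly0 mul0r.
  have nind : ~ indep (i |: G).
    move=> /asboolP h; have E := Gmax _ h (finset.subsetUr _ _).
    by move: iG'; rewrite -E in_setU1 eqxx.
  move/existsNP: nind => [q /not_implyP[q0 /existsNP[j /not_implyP[jG qj]]]].
  exists (q i), (fun l => - q l); split.
    apply/eqP => qi; apply: qj.
    move: q0; rewrite big_setU1 //= qi comp_mpoly0 mul0r add0r => /iG hG.
    by move: jG; rewrite in_setU1 => /orP[/eqP -> //|/hG].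
  move: q0; rewrite big_setU1 //= => /eqP; rewrite addr_eq0 => /eqP ->.
  by rewrite -sumrN; apply: eq_bigr => l _; rewrite comp_mpolyN mulNr.
exists (\prod_i Q i); first by apply/prodf_neq0 => i _; case: (Qp i).
exists (fun i j => (\prod_(l | l != i) Q l) * p i j) => i.
rewrite (bigD1 i) //= [Q i * _]mulrC rmorphM /= -mulrA; case: (Qp i) => _ ->.
by rewrite mulr_sumr; apply: eq_bigr => j _; rewrite rmorphM mulrA.
Qed.

End Independence.

Lemma deg_in_uniform_bound (K : nzRingType) n (mf : measure n) (T : finType)
    (p : T -> {mpoly K[n]}) : exists d, forall i, deg_in mf (fun e => e <= d)%N (p i).
Proof.
have /choice [d dP] i := deg_in_bounded mf (p i).
exists (\max_i d i)%N => i; apply: deg_inW (dP i) => x /leq_trans; apply.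
exact: leq_bigmax.
Qed.

(* K[x] is finite over K[f]; relations among generators cost a bounded degree,
   so comparing the number of monomials of weight at most T on both sides as T
   grows bounds the rank from below. *)
Theorem rank_lower_bound (K : closedFieldType) (n : nat)
    (f ft : n.-tuple {mpoly K[n]}) (w e : 'I_n -> nat) :
  (forall j, 0 < w j)%N -> (forall j, 0 < e j)%N ->
  (forall j, has_lead (wdeg w) ltn (e j) (tnth f j) (tnth ft j)) ->
  (forall x, (forall j, (tnth ft j).@[x] = 0) -> forall i, x i = 0) ->
  exists (B : finType) (b : B -> {mpoly K[n]}) (G : {set B}),
    [/\ forall h, span_in f b e predT h, indep f b G &
        (\prod_j e j <= #|G| * \prod_j w j)%N].
Proof.
move=> w0 e0 fl /origin_only_zero_nilpotent [s sP].
pose b (m : 'X_{1..n < s}) : {mpoly K[n]} := 'X_[m].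
have top := span_in_top e0 fl sP; rewrite -/b in top.
exists 'X_{1..n < s}, b.
have [G [_ iG [Q Q0 [p Qp]]]] := max_indep (indep0 (f := f) (b := b)).
exists G; split => // [h|].
  by have [d hd] := deg_in_bounded (wdeg w) h; apply: span_inW (top _ _ hd).
have [kQ hQ] := deg_in_bounded (wdeg e) Q.
have [kp hp] := deg_in_uniform_bound (wdeg e) (fun ij => p ij.1 ij.2).
pose kap := maxn kQ kp.
(* The relation expressing Q b_i through [G], as a vector of coefficients of the generators. *)
pose z (i l : 'X_{1..n < s}) : {mpoly K[n]} := (if l == i then Q else 0) - (if l \in G then p i l else 0).
have zdeg i l : deg_in (wdeg e) (fun x => x <= kap)%N (z i l).
  apply: deg_inB; case: ifP => _; try exact: deg_in0.
    by apply: deg_inW hQ => x xk; rewrite leq_max xk.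
  by apply: deg_inW (hp (i, l)) => x xk; rewrite leq_max xk orbT.
have z0 i : \sum_l (z i l \mPo f) * b l = 0.
  under eq_bigr => l _ do rewrite /z rmorphB mulrBl.
  rewrite sumrB /= (bigD1 i) //= eqxx [X in (_ + X) - _]big1 ?addr0 ?Qp; last first.
    by move=> l /negPf ->; rewrite comp_mpoly0 mul0r.
  rewrite [X in X - _]big_mkcond -sumrB big1 // => l _.
  by case: ifP => _; rewrite ?comp_mpoly0 ?mul0r subrr.
(* Monomials in x of weight at most [T], lifted to coefficient vectors, are independent together
   with the multiples of the relations [z i], i outside [G]: evaluation at [f] kills the relations,
   so the coefficients of the lifts vanish first. All these vectors have weight at most T + kap. *)
have count T : (#|wmon w T| + #|~: G| * #|wmon e T| <= #|{: 'X_{1..n < s}}| * #|wmon e (T + kap)|)%N.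
  rewrite leqNgt; apply/negP => lt.
  have /choice [q qP] (r : 'I_#|wmon w T|) : exists q : 'X_{1..n < s} -> {mpoly K[n]},
      'X_[enum_val r] = \sum_i (q i \mPo f) * b i /\
      forall i, deg_in (wdeg e) (fun x => x <= T)%N (q i).
    have [|q qE qd] := top T 'X_[enum_val r]; last by exists q.
    by apply: deg_inX; have := enum_valP r; rewrite inE.
  pose phi (d : 'I_#|wmon w T| + 'I_#|~: G| * 'I_#|wmon e T|) l :=
    match d with
    | inl r => q r l
    | inr ia => 'X_[enum_val ia.2] * z (enum_val ia.1) l
    end.
  have [||c [d cd] c0] := @mpoly_lin_dep K n e (T + kap) _ _ phi e0.
  - case=> [r|[i a]] l /=.
      by case: (qP r) => _ /(_ l); apply: deg_inW => x /leq_trans; apply; apply: leq_addr.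
    apply: (deg_inM (P1 := fun x => x <= T)%N) (zdeg _ _); first by move=> x y; lia.
    by apply: deg_inX; have := enum_valP a; rewrite inE.
  - by rewrite card_sum card_prod !card_ord.
  have ev : \sum_d c d *: (\sum_l (phi d l \mPo f) * b l) = 0.
    under eq_bigr => d' _ do rewrite scaler_sumr.
    rewrite exchange_big big1 // => l _ /=.
    under eq_bigr => d' _ do rewrite scalerAl -comp_mpolyZ.
    by rewrite -mulr_suml -(raddf_sum (comp_mpoly f)) c0 raddf0 mul0r.
  have cl r : c (inl r) = 0.
    move: r; apply: monomials_free; rewrite -[RHS]ev big_sumType /=.
    rewrite [X in _ = _ + X]big1 ?addr0 => [|[i a] _] /=.
      by apply: eq_bigr => r _; case: (qP r) => <-.
    under eq_bigr => l _ do rewrite rmorphM /= -mulrA.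
    by rewrite -mulr_sumr z0 mulr0 scaler0.
  case: d cd => [r|[i a]]; first by rewrite cl eqxx.
  apply/negP; rewrite negbK; apply/eqP.
  (* In a column outside [G] the only nonzero entry among the relations is [Q], in the row of the
     same index. *)
  have := c0 (enum_val i); rewrite big_sumType /= big1 ?add0r; last first.
    by move=> r _; rewrite cl scale0r.
  have iNG : enum_val i \notin G by have := enum_valP i; rewrite finset.in_setC.
  pose F i' a' := c (inr (i', a')) *: ('X_[enum_val a'] * z (enum_val i') (enum_val i)).
  rewrite (eq_bigr (fun ia => F ia.1 ia.2)) => [|[i' a'] _] //.
  rewrite -(pair_bigA _ F) /= (bigD1 i) //= [X in _ + X]big1 ?addr0 => [|i' i'i]; last first.
    rewrite big1 // => a' _; rewrite /F /z (negPf iNG) subr0.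
    suff /negPf -> : enum_val i != enum_val i' by rewrite mulr0 scaler0.
    by apply: contraNneq i'i => /enum_val_inj ->.
  rewrite /F /z eqxx (negPf iNG) subr0.
  under eq_bigr => a' _ do rewrite scalerAl.
  rewrite -mulr_suml => /eqP; rewrite mulf_eq0 (negPf Q0) orbF => /eqP h.
  exact: (monomials_free h a).
have cB : (#|{: 'X_{1..n < s}}| = #|G| + #|~: G|)%N by rewrite cardsC.
suff : (\prod_j e j + #|~: G| * \prod_j w j <= (#|G| + #|~: G|) * \prod_j w j)%N.
  by rewrite mulnDl leq_add2r.
apply: (@binomial_shift_le _ _ n (kap + \sum_j e j)) => T.
have h1 := card_wmon_ge T w0.
have h2 := card_wmon_ge T e0.
have h3 := card_wmon_le (T + kap) e0.
have h4 := count T; rewrite cB in h4.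
rewrite addnA; move: h1 h2 h3 h4.
move: (\prod_j e j)%N (\prod_j w j)%N #|wmon w T| #|wmon e T| #|wmon e (T + kap)| => E W nw ne nek.
move: #|G| #|~: G| 'C(_, _) 'C(_, _) => rho sig C1 C2 h1 h2 h3 h4.
have g1 := leq_mul (leqnn E) h1.
have g2 := leq_mul (leqnn (sig * W)%N) h2.
have g3 := leq_mul (leqnn ((rho + sig) * W)%N) h3.
have g4 := leq_mul (leqnn (E * W)%N) h4.
lia.
Qed.

Lemma deg_in_min (K : nzRingType) n (mf : measure n) (p : {mpoly K[n]}) : p != 0 ->
  exists o, [/\ deg_in mf (fun d => o <= d)%N p & pihomog mf o p != 0].
Proof.
move=> p0.
have ex : exists o, `[< exists m, p@_m != 0 /\ mf m = o >].
  by exists (mf (mlead p)); apply/asboolP; exists (mlead p); rewrite -mcoeff_msupp mlead_supp.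
case: (ex_minnP ex) => o /asboolP[m [pm mo]] omin; exists o; split.
  by move=> m' pm'; apply: omin; apply/asboolP; exists m'.
by apply: contraNneq pm => h; have := mcoeff_pihomog mf o p m; rewrite mo eqxx h mcoeff0 => <-.
Qed.

Lemma deg_in_sub_pihomog (K : nzRingType) n (mf : measure n) o (p : {mpoly K[n]}) :
  deg_in mf (fun d => o <= d)%N p -> deg_in mf (fun d => o < d)%N (p - pihomog mf o p).
Proof.
move=> hp m; rewrite mcoeffB mcoeff_pihomog; have [_|ne] := eqVneq (mf m) o.
  by rewrite subrr eqxx.
by rewrite subr0 => /hp om; rewrite ltn_neqAle eq_sym ne.
Qed.

(** In a domain the lowest forms multiply to something nonzero, so for nonzero [c] the order of
    [Q * c] is at most o + T. *)
Lemma order_mul_eq0 (K : idomainType) n (mf : measure n) o T (Q c : {mpoly K[n]}) :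
  deg_in mf (fun d => o <= d)%N Q -> pihomog mf o Q != 0 ->
  deg_in mf (fun d => d <= T)%N c -> deg_in mf (fun d => o + T < d)%N (Q * c) -> c = 0.
Proof.
move=> hQ Q0 hc hQc; apply: contrapT => /eqP cn0.
have [t [tc ct0]] := deg_in_min mf cn0.
have tT : (t <= T)%N.
  have [m] : exists m, (pihomog mf t c)@_m != 0.
    apply: contrapT => h; case/eqP: ct0; apply/mpolyP => m; rewrite mcoeff0.
    by apply/eqP/negPn/negP => ?; apply: h; exists m.
  by rewrite mcoeff_pihomog; have [<- /hc|] := eqVneq (mf m) t; rewrite ?eqxx.
pose Qo := pihomog mf o Q; pose co := pihomog mf t c.
have Qco0 : Qo * co != 0 by rewrite mulf_neq0.
have Qch : Qo * co \is (o + t).-homog for mf by apply: dhomogM; apply: pihomogP.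
have : deg_in mf (fun d => o + t < d)%N (Qo * co).
  have -> : Qo * co = Q * c - (Q * (c - co) + (Q - Qo) * co).
    by rewrite mulrBr mulrBl addrA subrK opprB addrC subrK.
  apply: deg_inB; first by apply: deg_inW hQc => d; lia.
  apply: deg_inD.
    by apply: (deg_inM _ hQ (deg_in_sub_pihomog tc)) => x y; lia.
  apply: (deg_inM (P2 := pred1 t) _ (deg_in_sub_pihomog hQ)).
    by move=> x y /= h /eqP ->; lia.
  by apply: deg_in_homog (pihomogP _ _ _); rewrite /=.
move=> h; case/eqP: Qco0; apply/mpolyP => m; rewrite mcoeff0.
apply/eqP/negPn/negP => Qm; have := h m Qm.
by move/dhomogP: Qch => /(_ m); rewrite mcoeff_msupp => /(_ Qm) ->; rewrite ltnn.
Qed.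

(* Conversely, elements of K[x] of order T + s lie in the part of order >= T
   of K[x] over K[f], so an independent family stays independent modulo a
   power of the maximal ideal at the origin. *)
Theorem rank_upper_bound (K : closedFieldType) (n : nat)
    (f ft : n.-tuple {mpoly K[n]}) (e : 'I_n -> nat)
    (B : finType) (b : B -> {mpoly K[n]}) (G0 : {set B}) :
  (forall j, 0 < e j)%N ->
  (forall j, has_lead (@mdeg n : measure n) (fun x y => y < x)%N (e j) (tnth f j) (tnth ft j)) ->
  (forall x, (forall j, (tnth f j).@[x] = 0) -> forall i, x i = 0) ->
  (forall x, (forall j, (tnth ft j).@[x] = 0) -> forall i, x i = 0) ->
  (forall h, span_in f b e predT h) -> indep f b G0 ->
  (#|G0| <= \prod_j e j)%N.
Proof.
move=> e0 fl /origin_only_zero_nilpotent [s' fs] /origin_only_zero_nilpotent [s fts] gens.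
case/max_indep => G [G0G iG [Q Q0 [p Qp]]].
apply: leq_trans (subset_leq_card G0G) _.
have low := span_in_low e0 gens fl fs fts.
have [o [oQ Qo0]] := deg_in_min (wdeg e) Q0.
(* Otherwise a nontrivial combination [h] of the products of monomials in [f] with the elements of
   [G] vanishes to order above T + o + s. By [span_in_low] it has coefficients of weight above T +
   o; after multiplication by [Q] these are compared with the coefficients [C j] of weight at most
   [T]. *)
have count T : (#|G| * #|wmon e T| <= 'C(T + (o + s) + n, n))%N.
  rewrite -card_wmon1 leqNgt; apply/negP => lt.
  pose phi (ja : 'I_#|G| * 'I_#|wmon e T|) : {mpoly K[n]} :=
    ('X_[enum_val ja.2] \mPo f) * b (enum_val ja.1).
  have [|c [[j0 a0] cja] c0] := @lin_dep K _ 'I_#|wmon (k := n) (fun=> 1%N) (T + (o + s))|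
     (fun ja r => (phi ja)@_(enum_val r)).
    by rewrite card_prod !card_ord.
  pose h := \sum_ja c ja *: phi ja.
  have hdeg : deg_in (@mdeg n : measure n) (fun d => T.+1 + o + s <= d)%N h.
    move=> m hm; rewrite leqNgt; apply: contra hm => hm; rewrite /h raddf_sum /=.
    have mm : (mdeg m < (T + (o + s)).+1)%N by move: hm => /=; lia.
    have mw : BMultinom mm \in wmon (fun=> 1%N) (T + (o + s)).
      rewrite inE /=; have -> : wdeg (fun=> 1%N) m = mdeg m.
        by rewrite mdegE; apply: eq_bigr => i _; rewrite muln1.
      by rewrite -ltnS.
    apply/eqP; rewrite -[RHS](c0 (enum_rank_in mw (BMultinom mm))); apply: eq_bigr => ja _.
    by rewrite mcoeffZ enum_rankK_in.
  have [q hq qdeg] := low (T.+1 + o)%N h hdeg.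
  pose C i : {mpoly K[n]} := \sum_(ja | enum_val ja.1 == i) c ja *: 'X_[enum_val ja.2].
  have Cdeg i : deg_in (wdeg e) (fun d => d <= T)%N (C i).
    apply: deg_in_sum => ja _; apply/deg_inZ/deg_inX.
    by have := enum_valP ja.2; rewrite inE.
  have hC : h = \sum_(j in G) (C j \mPo f) * b j.
    rewrite /h (partition_big (fun ja => enum_val ja.1) (mem G)) /=; last first.
      by move=> ja _; apply: enum_valP.
    apply: eq_bigr => j _; rewrite (raddf_sum (comp_mpoly f)) mulr_suml.
    by apply: eq_bigr => ja /eqP <-; rewrite /= comp_mpolyZ scalerAl.
  have QC j : j \in G -> Q * C j = \sum_i q i * p i j.
    move=> jG; apply/eqP; rewrite -subr_eq0; apply/eqP.
    apply: (iG (fun j => Q * C j - \sum_i q i * p i j) _ j jG).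
    under eq_bigr => l _ do rewrite rmorphB rmorphM [X in _ - X]rmorph_sum /= mulrBl -mulrA.
    rewrite sumrB -mulr_sumr -hC hq mulr_sumr.
    under eq_bigr => i _ do rewrite mulrCA Qp mulr_sumr.
    rewrite exchange_big /= -sumrB big1 // => l _.
    rewrite mulr_suml -sumrB big1 // => i _.
    by rewrite rmorphM mulrA subrr.
  have C0 j : j \in G -> C j = 0.
    move=> jG; apply: (order_mul_eq0 oQ Qo0 (Cdeg j)); rewrite QC //.
    apply: deg_in_sum => i _; apply: (deg_inM (P2 := predT)) (qdeg i) _ => //.
    by move=> x y; lia.
  have := C0 _ (enum_valP j0); rewrite /C.
  rewrite (eq_bigl (fun ja => (ja.1 == j0) && true)); last first.
    by move=> ja; rewrite andbT (inj_eq enum_val_inj).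
  pose F j a : {mpoly K[n]} := c (j, a) *: 'X_[enum_val a].
  rewrite (eq_bigr (fun ja => F ja.1 ja.2)) => [|[j a] _] //.
  rewrite -(pair_big (pred1 j0) predT F) /= big_pred1_eq.
  by move=> /monomials_free /(_ a0) ca; rewrite ca eqxx in cja.
apply: (@binomial_shift_le _ _ n (o + s)) => T.
apply: leq_trans (leq_mul (leqnn _) (card_wmon_ge T e0)) _.
by rewrite mulnCA leq_mul2l count orbT.
Qed.

(** * Linear changes of the generators of K[f] *)

Lemma linear_system_inv (K : fieldType) (V : lmodType K) k (A : 'M[K]_k) (f g : 'I_k -> V) :
  A \in unitmx -> (forall j, g j = \sum_i A j i *: f i) ->
  forall j, f j = \sum_i invmx A j i *: g i.
Proof.
move=> uA gE j; under eq_bigr => i _ do rewrite gE scaler_sumr.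
rewrite exchange_big /=.
under eq_bigr => l _ do (under eq_bigr => i _ do rewrite scalerA; rewrite -scaler_suml).
have AV l : \sum_i invmx A j i * A i l = (j == l)%:R.
  by have := congr1 (fun M : 'M_k => M j l) (mulVmx uA); rewrite !mxE.
rewrite (bigD1 j) //= [X in _ = _ + X]big1 ?addr0 => [|l lj].
  by rewrite AV eqxx scale1r.
by rewrite AV eq_sym (negPf lj) scale0r.
Qed.

Definition linear_forms (K : fieldType) k (A : 'M[K]_k) : k.-tuple {mpoly K[k]} :=
  [tuple \sum_i A j i *: 'X_i | j < k].

Lemma comp_linear_forms (K : fieldType) n k (A : 'M[K]_k) (f g : k.-tuple {mpoly K[n]})
    (q : {mpoly K[k]}) :
  (forall j, tnth g j = \sum_i A j i *: tnth f i) ->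
  q \mPo g = (q \mPo linear_forms A) \mPo f.
Proof.
move=> gE; apply: (mpoly_rmorph_eq (g1 := comp_mpoly g)
  (g2 := comp_mpoly f \o comp_mpoly (linear_forms A))) => [c|j] /=.
  by rewrite !comp_mpolyC.
have XE m (t : k.-tuple {mpoly K[m]}) i : 'X_i \mPo t = tnth t i.
  by rewrite /comp_mpoly mmapX mmap1U.
rewrite !XE tnth_mktuple gE (raddf_sum (comp_mpoly f)) /=.
by apply: eq_bigr => i _; rewrite comp_mpolyZ XE.
Qed.

Lemma linear_forms_inj (K : fieldType) k (A : 'M[K]_k) (q : {mpoly K[k]}) : A \in unitmx ->
  q \mPo linear_forms A = 0 -> q = 0.
Proof.
move=> uA q0; have uV : invmx A \in unitmx by rewrite unitmx_inv.
have := @linear_system_inv K {mpoly K[k]} k (invmx A) (fun i => 'X_i)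
  (tnth (linear_forms (invmx A))) uV.
rewrite invmxK => h.
have E : q \mPo [tuple 'X_i | i < k] = 0.
  rewrite (@comp_linear_forms _ _ _ A (linear_forms (invmx A))) ?q0 ?comp_mpoly0 // => j.
  by rewrite tnth_mktuple; apply: h => i; rewrite tnth_mktuple.
by rewrite -[q]comp_mpoly_id.
Qed.

Lemma indep_linear_change (K : fieldType) n k (A : 'M[K]_k) (f g : k.-tuple {mpoly K[n]})
    (B : finType) (b : B -> {mpoly K[n]}) (G : {set B}) :
  A \in unitmx -> (forall j, tnth g j = \sum_i A j i *: tnth f i) ->
  indep f b G -> indep g b G.
Proof.
move=> uA gE iG q q0 i iiG; apply: (linear_forms_inj uA).
apply: (iG (fun i => q i \mPo linear_forms A)) => //.
by rewrite -[RHS]q0; apply: eq_bigr => j _; rewrite (comp_linear_forms _ gE).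
Qed.

Lemma span_linear_change (K : fieldType) n k (A : 'M[K]_k) (f g : k.-tuple {mpoly K[n]})
    (B : finType) (b : B -> {mpoly K[n]}) e e' h :
  A \in unitmx -> (forall j, tnth g j = \sum_i A j i *: tnth f i) ->
  span_in f b e predT h -> span_in g b e' predT h.
Proof.
move=> uA gE [q -> _]; have fE := linear_system_inv uA gE.
exists (fun i => q i \mPo linear_forms (invmx A)) => //.
by apply: eq_bigr => i _; rewrite (comp_linear_forms _ fE).
Qed.

(** The rank of K[x] over K[f] = K[g] is bounded below through the top forms of [f] and above
    through the lowest forms of [g]. *)
Theorem lead_degrees_le (K : closedFieldType) n (A : 'M[K]_n)
    (f ft g gt : n.-tuple {mpoly K[n]}) (w e e' : 'I_n -> nat) :
  (forall j, 0 < w j)%N -> (forall j, 0 < e j)%N -> (forall j, 0 < e' j)%N ->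
  A \in unitmx -> (forall j, tnth g j = \sum_i A j i *: tnth f i) ->
  (forall j, has_lead (wdeg w) ltn (e j) (tnth f j) (tnth ft j)) ->
  (forall j, has_lead (@mdeg n : measure n) (fun x y => y < x)%N (e' j)
                      (tnth g j) (tnth gt j)) ->
  (forall x, (forall j, (tnth ft j).@[x] = 0) -> forall i, x i = 0) ->
  (forall x, (forall j, (tnth g j).@[x] = 0) -> forall i, x i = 0) ->
  (forall x, (forall j, (tnth gt j).@[x] = 0) -> forall i, x i = 0) ->
  (\prod_j e j <= \prod_j e' j * \prod_j w j)%N.
Proof.
move=> w0 e0 e'0 uA gE fl gl ft0 g0 gt0.
have [B [b [G [gens iG le]]]] := rank_lower_bound w0 e0 fl ft0.
apply: leq_trans le _; rewrite leq_mul2r; apply/orP; right.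
apply: (rank_upper_bound e'0 gl g0 gt0 _ (indep_linear_change uA gE iG)) => h.
exact: span_linear_change uA gE (gens h).
Qed.

(* Padding the system with zero equations makes the f_j algebraically
   dependent, so no element is independent over K[f]. *)
Theorem common_zero (K : closedFieldType) n (J : finType) (g : J -> {mpoly K[n]})
    (w : 'I_n -> nat) (e : J -> nat) :
  (#|J| < n)%N -> (forall i, 0 < w i)%N -> (forall j, 0 < e j)%N ->
  (forall j, g j \is (e j).-homog for (wdeg w)) ->
  exists x, (exists i, x i != 0) /\ forall j, (g j).@[x] = 0.
Proof.
move=> Jn w0 e0 hg; apply: contrapT => no.
pose f : n.-tuple {mpoly K[n]} :=
  [tuple oapp (fun r : 'I_#|J| => g (enum_val r)) 0 (insub (i : nat)) | i < n].
pose e' (i : 'I_n) := oapp (fun r : 'I_#|J| => e (enum_val r)) 1%N (insub (i : nat)).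
have e'0 i : (0 < e' i)%N by rewrite /e'; case: insub => /=.
have fl i : has_lead (wdeg w) ltn (e' i) (tnth f i) (tnth f i).
  split; last by rewrite subrr; apply: deg_in0.
  by rewrite tnth_mktuple /e'; case: insub => [r|] //=; exact: rpred0.
have [x x0|B [b [G [_ iG le]]]] := rank_lower_bound w0 e'0 fl.
  apply: contrapT => /existsNP [i /eqP xi]; apply: no; exists x; split; first by exists i.
  move=> j; have jn : (enum_rank j < n)%N by apply: leq_trans Jn; apply: ltnW; rewrite ltnS; apply: ltn_ord.
  by have := x0 (Ordinal jn); rewrite tnth_mktuple /= valK /= enum_rankK.
have : (0 < #|G|)%N.
  rewrite lt0n; apply: contraTneq le => ->; rewrite mul0n -ltnNge.
  by apply: prodn_gt0.
case/card_gt0P => i iiG; pose j0 := Ordinal Jn.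
have fj0 : tnth f j0 = 0 by rewrite tnth_mktuple insubN //= ltnn.
have : ('X_j0 : {mpoly K[n]}) = 0.
  apply: (iG (fun=> 'X_j0) _ i iiG); rewrite big1 // => l _.
  by rewrite /comp_mpoly mmapX mmap1U fj0 mul0r.
by move/eqP; rewrite -msize_poly_eq0 msizeX.
Qed.

(** * Lines and conics through a point *)

Section GradedPoly.
Variables (K : fieldType) (n : nat) (mf : measure n).
Implicit Types (P : pred nat) (p q : {poly {mpoly K[n]}}).

(* The grading of K[x][X] in which X has degree 1 and x is graded by mf. *)
Definition pdeg_in P p : Prop := forall k, deg_in mf (fun d => P (d + k)%N) p`_k.

Lemma pdeg_in0 P : pdeg_in P 0.
Proof. by move=> k; rewrite coef0; apply: deg_in0. Qed.

Lemma pdeg_inD P p q : pdeg_in P p -> pdeg_in P q -> pdeg_in P (p + q).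
Proof. by move=> hp hq k; rewrite coefD; apply: deg_inD. Qed.

Lemma pdeg_inN P p : pdeg_in P p -> pdeg_in P (- p).
Proof. by move=> hp k; rewrite coefN; apply: deg_inN. Qed.

Lemma pdeg_inW P P' p : (forall d, P d -> P' d) -> pdeg_in P p -> pdeg_in P' p.
Proof. by move=> PP' hp k; apply: deg_inW (hp k) => d; apply: PP'. Qed.

Lemma pdeg_inM (P1 P2 P : pred nat) p q :
  (forall a b, P1 a -> P2 b -> P (a + b)%N) ->
  pdeg_in P1 p -> pdeg_in P2 q -> pdeg_in P (p * q).
Proof.
move=> PP hp hq k; rewrite coefM; apply: deg_in_sum => i _.
apply: (deg_inM _ (hp i) (hq (k - i)%N)) => a b ha hb.
rewrite [X in P X](_ : _ = (a + i) + (b + (k - i)))%N; first exact: PP.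
by have := ltn_ord i; lia.
Qed.

Lemma pdeg_inC P (c : {mpoly K[n]}) : deg_in mf P c -> pdeg_in P c%:P.
Proof.
move=> hc [|k]; rewrite coefC /=; last exact: deg_in0.
by apply: deg_inW hc => d; rewrite addn0.
Qed.

Lemma pdeg_inXn P k : P k -> pdeg_in P 'X^k.
Proof.
move=> Pk l; rewrite coefXn; case: eqP => [->|_]; last exact: deg_in0.
by rewrite -mpolyC1; apply: deg_in_C.
Qed.

Lemma pdeg_in_scale P (c : K) p : pdeg_in P p -> pdeg_in P (c%:MP *: p).
Proof. by move=> hp k; rewrite coefZ mul_mpolyC; apply: deg_inZ. Qed.

Variable cmp : rel nat.
Hypothesis cmpD : forall a b x y, (a == x) || cmp a x -> cmp b y -> cmp (a + b)%N (x + y)%N.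
Hypothesis cmpB : forall d k e, (k <= e)%N -> cmp (d + k)%N e -> cmp d (e - k)%N.

(** The hypotheses on [cmp] hold for the strict order and for its reverse, so top and lowest forms
    are treated together. *)
Definition phas_lead e p pt : Prop :=
  pdeg_in (pred1 e) pt /\ pdeg_in (cmp^~ e) (p - pt).

Lemma phas_lead_weak e p pt : phas_lead e p pt ->
  pdeg_in (fun d => (d == e) || cmp d e) p.
Proof.
case=> h1 h2; rewrite -[p](subrK pt) addrC; apply: pdeg_inD.
  by apply: pdeg_inW h1 => d /= ->.
by apply: pdeg_inW h2 => d ->; rewrite orbT.
Qed.

Lemma phas_lead0 e : phas_lead e 0 0.
Proof. by split; rewrite ?subrr; apply: pdeg_in0. Qed.

Lemma phas_leadC (c : K) : phas_lead 0 c%:MP%:P c%:MP%:P.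
Proof. by split; [apply/pdeg_inC/deg_in_C | rewrite subrr; apply: pdeg_in0]. Qed.

Lemma phas_leadD e p pt q qt :
  phas_lead e p pt -> phas_lead e q qt -> phas_lead e (p + q) (pt + qt).
Proof.
move=> [h1 h2] [h3 h4]; split; first exact: pdeg_inD.
by rewrite opprD addrACA; apply: pdeg_inD.
Qed.

Lemma phas_leadM e e' p pt q qt :
  phas_lead e p pt -> phas_lead e' q qt -> phas_lead (e + e')%N (p * q) (pt * qt).
Proof.
move=> hp hq; case: (hp) (hq) => h1 h2 [h3 h4]; split.
  by apply: (pdeg_inM _ h1 h3) => a b /eqP -> /eqP ->; rewrite /= eqxx.
have -> : p * q - pt * qt = p * (q - qt) + (p - pt) * qt.
  by rewrite mulrBr mulrBl addrA subrK.
apply: pdeg_inD; first by apply: (pdeg_inM _ (phas_lead_weak hp) h4) => a b; apply: cmpD.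
apply: (pdeg_inM _ h2 h3) => a b /= ha /eqP ->.
by rewrite /= (addnC a) (addnC e); apply: cmpD; rewrite ?eqxx.
Qed.

Lemma phas_leadX e p pt k : phas_lead e p pt -> phas_lead (e * k)%N (p ^+ k) (pt ^+ k).
Proof.
move=> hp; elim: k => [|k IH]; first by rewrite muln0 !expr0 -polyC1 -mpolyC1; apply: phas_leadC.
by rewrite mulnS !exprS; apply: phas_leadM.
Qed.

Definition poly_subst N (u : 'I_N -> {poly {mpoly K[n]}}) : {mpoly K[N]} -> {poly {mpoly K[n]}} :=
  mmap (@polyC _ \o @mpolyC n K) u.

(** All monomials of [F] have the same degree, so their leading parts lie in the same degree and add
    up to [F] at the leading parts. *)
Lemma phas_lead_subst N (u ut : 'I_N -> {poly {mpoly K[n]}}) e d (F : {mpoly K[N]}) :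
  F \is d.-homog -> (forall l, phas_lead e (u l) (ut l)) ->
  phas_lead (e * d)%N (poly_subst u F) (poly_subst ut F).
Proof.
move=> /dhomogP hF hu; rewrite /poly_subst /mmap.
rewrite big_seq [X in phas_lead _ _ X]big_seq.
elim/big_ind2: _ => [|p pt q qt|m /hF <-]; [exact: phas_lead0|exact: phas_leadD|].
rewrite -[(e * _)%N]add0n; apply: phas_leadM; first exact: phas_leadC.
rewrite /= mdegE big_distrr /= /mmap1.
elim/big_ind3: _ => [|e1 p pt e2 q qt|l _]; last exact: phas_leadX.
  by rewrite -polyC1 -mpolyC1; apply: phas_leadC.
exact: phas_leadM.
Qed.

Lemma has_lead_coef e p pt k : (k <= e)%N -> phas_lead e p pt ->
  has_lead mf cmp (e - k)%N p`_k pt`_k.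
Proof.
move=> ke [h1 h2]; split.
  apply/dhomogP => m; rewrite mcoeff_msupp => /h1 /= /eqP <-.
  by rewrite addnK.
by rewrite -coefB => m /h2; apply: cmpB.
Qed.

End GradedPoly.

Section Substitution.
Variables (K : closedFieldType) (n N : nat).
Implicit Types (u : 'I_N -> {poly {mpoly K[n]}}) (F : {mpoly K[N]}).

Lemma eval_poly_subst u F (x : 'I_n -> K) s :
  (map_poly (meval x) (poly_subst u F)).[s] =
  F.@[fun l => (map_poly (meval x) (u l)).[s]].
Proof.
apply: (mpoly_rmorph_eq
  (g1 := horner_eval s \o (map_poly (meval x) \o mmap (@polyC _ \o @mpolyC n K) u))
  (g2 := meval _)) => [c|i] /=.
  by rewrite mmapC /= map_polyC /= /horner_eval hornerC !mevalC.
by rewrite mmapX mmap1U mevalXU.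
Qed.

Lemma comp_poly_subst u F (r : {poly {mpoly K[n]}}) :
  poly_subst u F \Po r = poly_subst (fun l => u l \Po r) F.
Proof.
apply: (mpoly_rmorph_eq
  (g1 := comp_poly r \o mmap (@polyC _ \o @mpolyC n K) u)
  (g2 := mmap (@polyC _ \o @mpolyC n K) _)) => [c|i] /=.
  by rewrite !mmapC /= comp_polyC.
by rewrite !mmapX !mmap1U.
Qed.

Lemma poly_eq0_horner (p : {poly K}) : (forall s, p.[s] = 0) -> p = 0.
Proof.
move=> p0; apply/eqP/negPn/negP => /closed_nonrootP [s].
by rewrite /root p0 eqxx.
Qed.

Lemma dhomog_eval_scale d F (a : K) (v : 'I_N -> K) : F \is d.-homog ->
  F.@[fun l => a * v l] = a ^+ d * F.@[v].
Proof.
move=> /dhomogP hF; rewrite !mevalE mulr_sumr; apply: eq_big_seq => m /hF /= <-.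
rewrite mulrCA; congr (_ * _); rewrite mdegE expr_sum -big_split /=.
by apply: eq_bigr => l _; rewrite exprMn.
Qed.

(* The top coefficient has weight 0, so it is constant and is read off at 0. *)
Lemma poly_subst_size (mf : measure n) e (U : {poly {mpoly K[n]}}) :
  (forall m, mf m = 0%N -> m = 0%MM) ->
  pdeg_in mf (fun d => d <= e)%N U -> map_poly (meval (fun=> 0)) U = 0 ->
  (size U <= e)%N.
Proof.
move=> mf0P hU U0; apply/leq_sizeP => k ek; apply/mpolyP => m; rewrite mcoeff0.
have Uk m' : (U`_k)@_m' != 0 -> m' = 0%MM.
  move=> /(hU k) h; apply: mf0P; apply/eqP; rewrite -leqn0 -(leq_add2r k) add0n.
  exact: leq_trans h ek.
apply/eqP/negPn/negP => Um; have m0 := Uk _ Um.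
have UkE : U`_k = ((U`_k)@_0%MM)%:MP.
  apply/mpolyP => m'; rewrite mcoeffC; have [->|m'0] := eqVneq m' 0%MM; first by rewrite mulr1.
  by rewrite mulr0; apply/eqP/negPn/negP => /Uk /eqP; rewrite (negPf m'0).
have := coef_map (meval (fun=> 0)) U k; rewrite /= U0 coef0 UkE mevalC => z.
by move: Um; rewrite m0 -z eqxx.
Qed.

Lemma map_poly_meval_eq0 e (U : {poly {mpoly K[n]}}) x : (size U <= e)%N ->
  (forall k, (k < e)%N -> (U`_k).@[x] = 0) -> map_poly (meval x) U = 0.
Proof.
move=> sU hU; apply/polyP => k; rewrite coef_map coef0 /=.
have [/hU //|ek] := ltnP k e.
by rewrite nth_default ?meval0 // (leq_trans sU).
Qed.

End Substitution.

(* Taylor coefficients of p at 1 and at -1: by Hermite interpolation they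
   determine p as soon as its degree is less than 2 d. *)
Definition hermite (A : comNzRingType) (d : nat) (a : 'I_(d + d)) (p : {poly A}) : A :=
  match split a with
  | inl l => (p \Po ('X + 1%:P))`_l
  | inr l => (p \Po ('X - 1%:P))`_l
  end.

Lemma comp_poly_shift_low (K : fieldType) d (c : K) (p : {poly K}) :
  (forall l, (l < d)%N -> (p \Po ('X + c%:P))`_l = 0) -> ('X - c%:P) ^+ d %| p.
Proof.
move=> h; have tk : take_poly d (p \Po ('X + c%:P)) = 0.
  apply/polyP => l; rewrite coef_take_poly coef0; case: ifP => // ld; exact: h.
have pE : p = (p \Po ('X + c%:P)) \Po ('X - c%:P).
  by rewrite -comp_polyA comp_polyD comp_polyX comp_polyC subrK comp_polyXr.
rewrite pE -(poly_take_drop d (p \Po ('X + c%:P))) tk add0r comp_polyM comp_Xn_poly.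
exact: dvdp_mull.
Qed.

(** Both (X - 1)^d and (X + 1)^d divide [p]; they are coprime because 1 and -1 differ, and their
    product has degree 2 d. *)
Lemma hermite_inj (K : fieldType) d (p : {poly K}) : 2%:R != 0 :> K ->
  (size p <= d + d)%N -> (forall a : 'I_(d + d), hermite a p = 0) -> p = 0.
Proof.
move=> two sp hp.
have d1 : ('X - 1%:P) ^+ d %| p.
  apply: comp_poly_shift_low => l ld; have := hp (lshift d (Ordinal ld)).
  by rewrite /hermite (unsplitK (inl (Ordinal ld))).
have d2 : ('X - (-1)%:P) ^+ d %| p.
  apply: comp_poly_shift_low => l ld; have := hp (rshift d (Ordinal ld)).
  by rewrite /hermite (unsplitK (inr (Ordinal ld))) polyCN.
have co : coprimep (('X - 1%:P : {poly K}) ^+ d) (('X - (-1)%:P) ^+ d).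
  apply/coprimep_expl/coprimep_expr; apply: coprimep_XsubC2.
  by rewrite -opprD oppr_eq0 -(natrD _ 1 1).
have : ('X - 1%:P) ^+ d * ('X - (-1)%:P) ^+ d %| p by rewrite Gauss_dvdp // d1 d2.
apply: contraTeq => p0; apply/negP => /(dvdp_leq p0).
rewrite size_mul ?expf_neq0 ?polyXsubC_eq0 // !size_exp_XsubC addnS /= leqNgt ltnS sp //.
Qed.

(** The points 1 and -1 lie in [K], so Taylor coefficients depend on the coefficients of [H] through
    a matrix over [K]. *)
Lemma hermite_linear (K : fieldType) n d (a : 'I_(d + d)) (H : {poly {mpoly K[n]}}) :
  (size H <= d + d)%N ->
  hermite a H = \sum_(c < d + d) hermite a ('X^c : {poly K}) *: H`_c.
Proof.
move=> sH.
have {1}-> : H = \sum_(c < d + d) H`_c *: 'X^c.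
  rewrite -poly_def; apply/polyP => i; rewrite coef_poly; case: ltnP => // ih.
  by rewrite nth_default // (leq_trans sH).
have XE (c : nat) (r : {poly K}) l : ('X^c \Po map_poly (@mpolyC n K) r)`_l = (('X^c \Po r)`_l)%:MP.
  by rewrite -coef_map map_comp_poly map_polyXn.
rewrite /hermite; case: split => l.
  rewrite (raddf_sum (comp_poly _)) coef_sum; apply: eq_bigr => c _ /=.
  rewrite comp_polyZ coefZ mulrC.
  rewrite (_ : 'X + 1%:P = map_poly (@mpolyC n K) ('X + 1%:P)) ?XE ?mul_mpolyC //.
  by rewrite rmorphD /= map_polyX map_polyC /= mpolyC1.
rewrite (raddf_sum (comp_poly _)) coef_sum; apply: eq_bigr => c _ /=.
rewrite comp_polyZ coefZ mulrC.
rewrite (_ : 'X - 1%:P = map_poly (@mpolyC n K) ('X - 1%:P)) ?XE ?mul_mpolyC //.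
by rewrite rmorphB /= map_polyX map_polyC /= mpolyC1.
Qed.

Lemma hermite_sum (K : fieldType) d (a : 'I_(d + d)) (z : 'I_(d + d) -> K) :
  hermite a (\sum_c z c *: 'X^c) = \sum_c z c * hermite a ('X^c : {poly K}).
Proof.
by rewrite /hermite; case: split => l; rewrite (raddf_sum (comp_poly _)) coef_sum;
  apply: eq_bigr => c _ /=; rewrite comp_polyZ coefZ.
Qed.

(** * Passage from coefficients to Taylor coefficients *)

Section HermiteMatrix.
Variables (K : fieldType) (k m : nat) (deg : 'I_k -> nat).
Let J : finType := {i : 'I_k & 'I_(deg i + deg i)}.
Variable (idx : 'I_m -> J).

(** Block diagonal, with one interpolation block for each hypersurface; [idx] flattens the pairs of
    a block and a position in it. *)
Definition hermite_mx : 'M[K]_m := \matrix_(r, s)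
  if tag (idx r) == tag (idx s) then hermite (tagged (idx r)) 'X^(tagged (idx s)) else 0.

Hypothesis idx_bij : bijective idx.

Lemma big_index (R : Type) (x : R) (op : Monoid.com_law x)
    (G : forall i, 'I_(deg i + deg i) -> R) :
  \big[op/x]_s G (tag (idx s)) (tagged (idx s)) = \big[op/x]_i \big[op/x]_c G i c.
Proof.
rewrite (sig_big_dep predT (fun _ => predT) (fun i (c : 'I_(deg i + deg i)) => G i c)) /=.
by rewrite (reindex idx) //; apply: onW_bij.
Qed.

Lemma hermite_mxE r (V : lmodType K) (h : forall i, 'I_(deg i + deg i) -> V) :
  \sum_s hermite_mx r s *: h (tag (idx s)) (tagged (idx s)) =
  \sum_(c < deg (tag (idx r)) + deg (tag (idx r)))
    hermite (tagged (idx r)) 'X^c *: h (tag (idx r)) c.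
Proof.
under eq_bigr => s _ do rewrite mxE.
rewrite (big_index _ (fun i (c : 'I_(deg i + deg i)) =>
  (if tag (idx r) == i then hermite (tagged (idx r)) 'X^c else 0) *: h i c)).
rewrite (bigD1 (tag (idx r))) //= [X in _ + X]big1 ?addr0 => [|i ir].
  by apply: eq_bigr => c _; rewrite eqxx.
by rewrite big1 // => c _; rewrite eq_sym (negPf ir) scale0r.
Qed.

(** A vector killed by the matrix is a family of polynomials [p i] with vanishing Taylor data, to
    which [hermite_inj] applies. *)
Lemma hermite_mx_unit : 2%:R != 0 :> K -> hermite_mx \in unitmx.
Proof.
move=> two; rewrite -unitmx_tr -row_free_unit -kermx_eq0.
apply/negPn/negP => /rowV0Pn [u /sub_kermxP uA un0].
case: idx_bij => inv idxK invK.
case/eqP: un0; apply/rowP => s; rewrite mxE.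
pose z i (c : 'I_(deg i + deg i)) : K := u 0 (inv (Tagged (fun i => 'I_(deg i + deg i)) c)).
have zE r : u 0 r = z (tag (idx r)) (tagged (idx r)).
  by rewrite /z -[in LHS](idxK r); case: (idx r).
pose p i : {poly K} := \sum_c z i c *: 'X^c.
have p0 i : p i = 0.
  apply: (@hermite_inj _ (deg i)) => // [|a].
    apply: leq_trans (size_sum _ _ _) _; apply/bigmax_leqP => c _.
    by apply: leq_trans (size_scale_leq _ _) _; rewrite size_polyXn.
  rewrite hermite_sum; pose r := inv (Tagged (fun i => 'I_(deg i + deg i)) a).
  have rE : idx r = Tagged (fun i => 'I_(deg i + deg i)) a by rewrite /r invK.
  have := hermite_mxE r (V := K^o) z; rewrite rE /= => E.
  under eq_bigr => c _ do rewrite mulrC.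
  rewrite -[LHS]E; have := congr1 (fun M : 'rV_m => M 0 r) uA; rewrite !mxE => uA0.
  by rewrite -[RHS]uA0; apply: eq_bigr => s' _; rewrite [in RHS]mxE [RHS]mulrC zE.
rewrite zE.
have := congr1 (fun q : {poly K} => q`_(tagged (idx s))) (p0 (tag (idx s))).
rewrite coef0 coef_sum (bigD1 (tagged (idx s))) //= coefZ coefXn eqxx mulr1.
rewrite big1 ?addr0 // => c cs; rewrite coefZ coefXn.
by case: eqP => [E|]; rewrite ?mulr0 //; case/eqP: cs; apply/val_inj.
Qed.

End HermiteMatrix.

Lemma wdeg_eq0 n (w : 'I_n -> nat) (m : 'X_{1..n}) : (forall i, 0 < w i)%N ->
  wdeg w m = 0%N -> m = 0%MM.
Proof.
by move=> w0 wm; apply/eqP; rewrite -mdeg_eq0 -leqn0 -wm mdeg_le_wdeg.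
Qed.

Lemma meval_insert0 (K : comNzRingType) n N (j0 : 'I_N.+1) (y : 'I_N -> {mpoly K[n]}) x l :
  (insert0 j0 y l).@[x] = insert0 j0 (fun r => (y r).@[x]) l.
Proof. by rewrite /insert0; case: unlift => [r|] //; rewrite meval0. Qed.

Lemma eq_insert0 (A : nzRingType) N (j0 : 'I_N.+1) (y y' : 'I_N -> A) : y =1 y' ->
  insert0 j0 y =1 insert0 j0 y'.
Proof. by move=> yy l; rewrite /insert0; case: unlift. Qed.

(** As E^2 = 1, the constant term of the factor of [P] cancels. Up to terms of order two in X, V, W
    the conic becomes a line in direction E V + W. *)
Lemma conic_shift (R : comNzRingType) (P V W X E : R) : E * E = 1 ->
  P * ((X + E) ^+ 2 - 1) + (V * (X + E) + W) =
  (P * (E *+ 2)) * X + (E * V + W) + (P * X ^+ 2 + V * X).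
Proof. by move=> <-; ring. Qed.

Lemma prod_rev_ord_fact n : (\prod_(c < n) (n - c) = n`!)%N.
Proof.
elim: n => [|n IH]; first by rewrite big_ord0.
by rewrite big_ord_recl subn0 factS -IH; congr (_ * _)%N; apply: eq_bigr => c _.
Qed.

(** Induction from d = 2, where 16 < 24; the step rests on 2 (D + 1)^2 <= (2 D + 2) (2 D + 1). For d
    = 1 the two sides agree. *)
Lemma fact_double_gt d : (1 < d)%N -> (d`! * d`! * 2 ^ d < (d + d)`!)%N.
Proof.
case: d => [//|[//|d]] _; elim: d => [//|d]; move: d.+2 => D IH.
rewrite addnS addSn !factS expnS.
have E : (D.+1 * D.+1 * 2 <= (D + D).+2 * (D + D).+1)%N by nia.
have -> : (D.+1 * D`! * (D.+1 * D`!) * (2 * 2 ^ D) = (D.+1 * D.+1 * 2) * (D`! * D`! * 2 ^ D))%N.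
  by move: D`! (2 ^ D)%N => x p; lia.
rewrite [X in (_ < X)%N]mulnA; apply: leq_ltn_trans (leq_mul E (leqnn _)) _.
by rewrite ltn_pmul2l.
Qed.

Lemma ltn_prod_pos (I : finType) (i0 : I) (a b : I -> nat) :
  (forall i, a i < b i)%N -> (\prod_i a i < \prod_i b i)%N.
Proof.
move=> ab; rewrite (bigD1 i0) //= [X in (_ < X)%N](bigD1 i0) //=.
apply: leq_ltn_trans (leq_mul (leqnn _) (leq_prod _)) _ => [i _|]; first exact: ltnW (ab i).
rewrite ltn_pmul2r //; apply: prodn_gt0 => i.
exact: leq_ltn_trans (ab i).
Qed.

(** * Existence of lines and conics *)

Section LinesAndConics.
Variables (K : closedFieldType) (N k : nat).
Variables (F : 'I_k -> {mpoly K[N.+1]}) (deg : 'I_k -> nat).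
Variables (p0 : 'I_N.+1 -> K) (j0 : 'I_N.+1).
Hypothesis homF : forall i, F i \is (deg i).-homog.
Hypothesis Fp0 : forall i, (F i).@[p0] = 0.

(** The point [p0] itself is reached at s = infinity. The vector y = 0 always satisfies the
    condition, so solutions must be nonzero to give lines. *)
Definition line_in (y : 'I_N -> K) : Prop :=
  forall i s, (F i).@[fun l => s * p0 l + insert0 j0 y l] = 0.

Definition conic_in (c : K) (v w : 'I_N -> K) : Prop :=
  forall i s, (F i).@[fun l => (s ^+ 2 - c) * p0 l + insert0 j0 (fun r => s * v r + w r) l] = 0.

Lemma F_scale_p0 i a : (F i).@[fun l => a * p0 l] = 0.
Proof. by rewrite (dhomog_eval_scale _ _ (homF i)) Fp0 mulr0. Qed.

Section Line.
Variables (n : nat) (a : K) (y : 'I_N -> {mpoly K[n]}) (mf : measure n).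

(** A generic line, with a direction given by polynomials. The factor [a] is 1 for lines themselves
    and twice a sign for the tangent lines of conics. *)
Definition uline (l : 'I_N.+1) : {poly {mpoly K[n]}} :=
  (a * p0 l)%:MP *: 'X + (insert0 j0 y l)%:P.

Lemma eval_uline i x s : (map_poly (meval x) (poly_subst uline (F i))).[s] =
  (F i).@[fun l => s * (a * p0 l) + insert0 j0 (fun r => (y r).@[x]) l].
Proof.
rewrite eval_poly_subst; apply: meval_eq => l; rewrite /uline rmorphD /=.
rewrite -mul_polyC rmorphM /= !map_polyC map_polyX hornerD hornerM !hornerC hornerX /=.
by rewrite mevalC mulrC meval_insert0.
Qed.

Hypothesis hy : forall r, deg_in mf (pred1 1%N) (y r).
Hypothesis mf0P : forall m, mf m = 0%N -> m = 0%MM.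

Lemma pdeg_uline l : pdeg_in mf (pred1 1%N) (uline l).
Proof.
apply: pdeg_inD; first by apply: pdeg_in_scale; rewrite -['X]expr1; apply: pdeg_inXn.
by apply: pdeg_inC; rewrite /insert0; case: unlift => [r|]; [apply: hy | apply: deg_in0].
Qed.

Lemma eval_uline0 i : map_poly (meval (fun=> 0)) (poly_subst uline (F i)) = 0.
Proof.
apply: poly_eq0_horner => s; rewrite eval_uline -[RHS](F_scale_p0 i (s * a)).
apply: meval_eq => l; rewrite mulrA /insert0; case: unlift => [r|]; last by rewrite addr0.
suff -> : (y r).@[fun=> 0] = 0 by rewrite addr0.
have h := @hy r; rewrite mevalE big_seq big1 // => m.
rewrite mcoeff_msupp => /h /= /eqP m1.
have [l' ml'] : exists l', m l' != 0%N.
  apply: contrapT => z; have : mf m = 0%N.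
    rewrite -(mf0 (s := mf)); congr (mf _); apply/mnmP => l'; rewrite mnm0E.
    by apply/eqP/negPn/negP => ?; apply: z; exists l'.
  by rewrite m1.
by rewrite (bigD1 l') //= expr0n (negPf ml') mul0r mulr0.
Qed.

Lemma phas_lead_uline cmp i :
  (forall a b x z, (a == x) || cmp a x -> cmp b z -> cmp (a + b)%N (x + z)%N) ->
  phas_lead mf cmp (deg i) (poly_subst uline (F i)) (poly_subst uline (F i)).
Proof.
move=> cmpD; rewrite -[deg i]mul1n; apply: phas_lead_subst => // l.
by split; [apply: pdeg_uline | rewrite subrr; apply: pdeg_in0].
Qed.

(** The coefficient of X^(deg i) is the value of [F i] at a multiple of [p0], hence zero: only
    [deg i] conditions remain. *)
Lemma line_in_of_coefs i x :
  (forall c, (c < deg i)%N -> ((poly_subst uline (F i))`_c).@[x] = 0) ->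
  forall s, (F i).@[fun l => s * (a * p0 l) + insert0 j0 (fun r => (y r).@[x]) l] = 0.
Proof.
move=> h s; rewrite -eval_uline (map_poly_meval_eq0 (e := deg i)) ?horner0 //.
apply: (poly_subst_size (mf := mf)) => //; last exact: eval_uline0.
have [] := phas_lead_uline (cmp := ltn) i; first by move=> ? ? ? ? /=; lia.
by move=> h1 _; apply: pdeg_inW h1 => d /eqP ->.
Qed.

End Line.

Lemma ltn_cmpD a b x y : (a == x) || ltn a x -> ltn b y -> ltn (a + b)%N (x + y)%N.
Proof. move=> /=; lia. Qed.

Lemma ltn_cmpB d l e : (l <= e)%N -> ltn (d + l)%N e -> ltn d (e - l)%N.
Proof. move=> /=; lia. Qed.

Lemma card_indices : #|{: {i : 'I_k & 'I_(deg i)}}| = (\sum_i deg i)%N.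
Proof.
rewrite card_tagged sumnE big_map big_enum /=.
by apply: eq_bigr => i _; rewrite card_ord.
Qed.

Lemma exists_line : (\sum_i deg i < N)%N -> exists y, (exists r, y r != 0) /\ line_in y.
Proof.
move=> dN; pose yX (r : 'I_N) : {mpoly K[N]} := 'X_r.
pose w1 : 'I_N -> nat := fun=> 1%N.
have hy r : deg_in (wdeg w1) (pred1 1%N) (yX r) by apply: deg_inX; rewrite /= wdegU.
have mfP m : wdeg w1 m = 0%N -> m = 0%MM by apply: wdeg_eq0.
pose g (ic : {i : 'I_k & 'I_(deg i)}) := (poly_subst (uline 1 yX) (F (tag ic)))`_(tagged ic).
have [||ic||y [y0 yg]] := @common_zero K N _ g w1 (fun ic => deg (tag ic) - tagged ic)%N.
- by rewrite card_indices.
- by [].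
- by rewrite subn_gt0.
- move=> ic; have := phas_lead_uline 1 hy (tag ic) ltn_cmpD.
  by case/(has_lead_coef ltn_cmpB (ltnW (ltn_ord (tagged ic)))).
exists y; split => // i s.
rewrite -[RHS](line_in_of_coefs (a := 1) hy mfP (i := i) (x := y) _ s); last first.
  by move=> c ci; apply: (yg (Tagged (fun i => 'I_(deg i)) (Ordinal ci))).
by apply: meval_eq => l; rewrite mul1r; congr (_ + _); apply: eq_insert0 => r; rewrite mevalXU.
Qed.


Section Conic.
Hypothesis two_neq0 : 2%:R != 0 :> K.

Definition vX (r : 'I_N) : {mpoly K[N + N]} := 'X_(lshift N r).
Definition wX (r : 'I_N) : {mpoly K[N + N]} := 'X_(rshift N r).

(* For c = 0 these are the top forms of the case c = 1, v and w being given
   the weights 1 and 2. *)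
Definition uconic (c : K) (l : 'I_N.+1) : {poly {mpoly K[N + N]}} :=
  (p0 l)%:MP *: ('X^2 - c%:MP%:P) + ((insert0 j0 vX l)%:P * 'X + (insert0 j0 wX l)%:P).

Definition conic_weight (r : 'I_(N + N)) : nat := if split r is inl _ then 1 else 2.

Lemma conic_weight_gt0 r : (0 < conic_weight r)%N.
Proof. by rewrite /conic_weight; case: split. Qed.

Lemma eval_uconic c i x s : (map_poly (meval x) (poly_subst (uconic c) (F i))).[s] =
  (F i).@[fun l => (s ^+ 2 - c) * p0 l +
    insert0 j0 (fun r => s * x (lshift N r) + x (rshift N r)) l].
Proof.
rewrite eval_poly_subst; apply: meval_eq => l; rewrite /uconic -mul_polyC.
rewrite !rmorphD !rmorphM /= rmorphB /= map_polyXn !map_polyC map_polyX.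
rewrite !hornerD !hornerM hornerD hornerN hornerXn !hornerC hornerX /= !mevalC.
rewrite mulrC !meval_insert0 /insert0; case: unlift => [r|]; last by rewrite mul0r !addr0.
by rewrite !mevalXU [s * _]mulrC.
Qed.

Lemma pdeg_insert0 n (mf : measure n) P (y : 'I_N -> {mpoly K[n]}) l :
  (forall r, deg_in mf P (y r)) -> pdeg_in mf P (insert0 j0 y l)%:P.
Proof.
move=> hy; apply: pdeg_inC; rewrite /insert0; case: unlift => [r|]; first exact: hy.
exact: deg_in0.
Qed.

(** X^2, v X and w all have weight 2; the two conics differ by a multiple of [p0], of weight 0. *)
Lemma phas_lead_uconic l : phas_lead (wdeg conic_weight) ltn 2 (uconic 1 l) (uconic 0 l).
Proof.
split.
  rewrite /uconic mpolyC0 polyC0 subr0; apply: pdeg_inD.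
    by apply/pdeg_in_scale/pdeg_inXn.
  apply: pdeg_inD.
    apply: (pdeg_inM (P1 := pred1 1%N) (P2 := pred1 1%N)).
    - by move=> a b /eqP -> /eqP ->.
    - apply: pdeg_insert0 => r; apply: deg_inX.
      by rewrite /= wdegU /conic_weight (unsplitK (inl r)).
    - by rewrite -['X]expr1; apply: pdeg_inXn.
  apply: pdeg_insert0 => r; apply: deg_inX.
  by rewrite /= wdegU /conic_weight (unsplitK (inr r)).
rewrite /uconic [X in _ - X]addrC opprD addrA addrK -scalerBr opprB addrC addrA subrK.
rewrite mpolyC0 polyC0 sub0r; apply: pdeg_in_scale; apply: pdeg_inN.
by apply: pdeg_inC; apply: deg_in_C.
Qed.

Lemma map_conic0 c i : map_poly (meval (fun=> 0)) (poly_subst (uconic c) (F i)) = 0.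
Proof.
apply: poly_eq0_horner => s; rewrite eval_uconic -[RHS](F_scale_p0 i (s ^+ 2 - c)).
apply: meval_eq => l; rewrite /insert0; case: unlift => [r|]; last by rewrite addr0.
by rewrite mulr0 !addr0.
Qed.

Lemma phas_lead_conic i : phas_lead (wdeg conic_weight) ltn (deg i + deg i)%N
  (poly_subst (uconic 1) (F i)) (poly_subst (uconic 0) (F i)).
Proof.
have -> : (deg i + deg i = 2 * deg i)%N by rewrite mul2n addnn.
by apply: (phas_lead_subst ltn_cmpD) => // l; apply: phas_lead_uconic.
Qed.

(** The coefficient of X^(2 deg i) vanishes because [p0] is a zero of [F i], which leaves 2 deg i
    equations. *)
Lemma size_conic c i : c = 0 \/ c = 1 ->
  (size (poly_subst (uconic c) (F i)) <= deg i + deg i)%N.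
Proof.
move=> hc; apply: (poly_subst_size (mf := wdeg conic_weight)).
- by move=> m; apply: wdeg_eq0 conic_weight_gt0.
- have h := phas_lead_conic i; case: hc => ->.
    by case: h => h _; apply: pdeg_inW h => d /eqP ->.
  by apply: pdeg_inW (phas_lead_weak h) => d /orP[/eqP -> //|/ltnW].
exact: map_conic0.
Qed.

Lemma conic_in_of_coefs c x : c = 0 \/ c = 1 ->
  (forall i l, (l < deg i + deg i)%N -> ((poly_subst (uconic c) (F i))`_l).@[x] = 0) ->
  conic_in c (fun r => x (lshift N r)) (fun r => x (rshift N r)).
Proof.
move=> hc h i s; rewrite -eval_uconic.
by rewrite (map_poly_meval_eq0 (size_conic i hc)) ?horner0 // => l; apply: h.
Qed.

(* The part of lowest order in (v, w) of the conic at X = eps, eps^2 = 1. *)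
Definition tangent_line (eps : K) : 'I_N.+1 -> {poly {mpoly K[N + N]}} :=
  uline (eps *+ 2) (fun r => eps%:MP * vX r + wX r).

Lemma deg_tangent_direction eps r :
  deg_in (@mdeg (N + N) : measure _) (pred1 1%N) (eps%:MP * vX r + wX r).
Proof.
apply: deg_inD; last by apply: deg_inX; rewrite /= mdeg1.
by rewrite mul_mpolyC; apply/deg_inZ/deg_inX; rewrite /= mdeg1.
Qed.

Lemma phas_lead_shifted_uconic eps l : eps * eps = 1 ->
  phas_lead (@mdeg (N + N) : measure _) (fun a b => b < a)%N 1
    (uconic 1 l \Po ('X + eps%:MP%:P)) (tangent_line eps l).
Proof.
move=> ee; split; first by apply: pdeg_uline => r; apply: deg_tangent_direction.
have -> : uconic 1 l \Po ('X + eps%:MP%:P) =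
    tangent_line eps l + ((p0 l)%:MP *: 'X^2 + (insert0 j0 vX l)%:P * 'X).
  rewrite /uconic /tangent_line /uline -!mul_polyC !comp_polyD !comp_polyM.
  rewrite comp_polyB comp_Xn_poly !comp_polyC !comp_polyX mpolyC1 polyC1.
  rewrite conic_shift; last by rewrite -polyCM -mpolyCM ee mpolyC1 polyC1.
  congr (_ * _ + _ + _).
    by rewrite mulrC mpolyCM polyCM mpolyCMn polyCMn.
  rewrite /insert0; case: unlift => [r|]; first by rewrite polyCD polyCM.
  by rewrite polyC0 mulr0 addr0.
rewrite addrC addKr; apply: pdeg_inD.
  by apply/pdeg_in_scale/pdeg_inXn.
apply: (pdeg_inM (P1 := pred1 1%N) (P2 := pred1 1%N)).
- by move=> a b /eqP -> /eqP ->.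
- by apply: pdeg_insert0 => r; apply: deg_inX; rewrite /= mdeg1.
- by rewrite -['X]expr1; apply: pdeg_inXn.
Qed.


Lemma exists_conic : (0 < k)%N -> (forall i, 1 < deg i)%N -> (\sum_i deg i = N)%N ->
  (forall y, line_in y -> forall r, y r = 0) ->
  exists c v w, [/\ c = 0 \/ c = 1, exists r, v r != 0 \/ w r != 0 & conic_in c v w].
Proof.
move=> k0 deg1 degN noline; apply: contrapT => no.
have deg0 i : (0 < deg i)%N := ltnW (deg1 i).
(* The negated goal says that for c = 0 and c = 1 only the degenerate solution exists. *)
have triv c x : c = 0 \/ c = 1 ->
    conic_in c (fun r => x (lshift N r)) (fun r => x (rshift N r)) -> forall r, x r = 0.
  move=> hc hx r; apply: contrapT => /eqP xr; apply: no.
  exists c, (fun r => x (lshift N r)), (fun r => x (rshift N r)); split => //.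
  rewrite -(splitK r) in xr; case: (split r) xr => r' xr; exists r'; [by left|by right].
pose J : finType := {i : 'I_k & 'I_(deg i + deg i)}.
have cJ : #|J| = (N + N)%N.
  rewrite card_tagged sumnE big_map big_enum /= -degN -big_split /=.
  by apply: eq_bigr => i _; rewrite card_ord.
pose idx (r : 'I_(N + N)) : J := enum_val (cast_ord (esym cJ) r).
have idx_bij : bijective idx.
  exists (fun j => cast_ord cJ (enum_rank j)) => [r|j].
    by rewrite /idx enum_valK cast_ordKV.
  by rewrite /idx cast_ordK enum_rankK.
pose H c i := poly_subst (uconic c) (F i).
pose f c := [tuple (H c (tag (idx r)))`_(tagged (idx r)) | r < N + N].
pose g := [tuple hermite (tagged (idx r)) (H 1 (tag (idx r))) | r < N + N].
(* The lowest forms of the Taylor coefficients in [g]; [elow] below records their degrees. *)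
pose low d i (a : 'I_(d + d)) : {mpoly K[N + N]} := match split a with
  | inl l => (poly_subst (tangent_line 1) (F i))`_l
  | inr l => (poly_subst (tangent_line (-1)) (F i))`_l
  end.
pose gt := [tuple low _ (tag (idx r)) (tagged (idx r)) | r < N + N].
pose e r := (deg (tag (idx r)) + deg (tag (idx r)) - tagged (idx r))%N.
pose elow d (a : 'I_(d + d)) := match split a with inl l => (d - l)%N | inr l => (d - l)%N end.
pose e' r := elow _ (tagged (idx r)).
have fE c r : tnth (f c) r = (H c (tag (idx r)))`_(tagged (idx r)) by exact: tnth_mktuple.
have gtE r : tnth gt r = low _ (tag (idx r)) (tagged (idx r)) by exact: tnth_mktuple.
have gE0 r : tnth g r = hermite (tagged (idx r)) (H 1 (tag (idx r))) by exact: tnth_mktuple.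
clearbody f g gt.
have zero_of_f c x : c = 0 \/ c = 1 -> (forall r, (tnth (f c) r).@[x] = 0) -> forall r, x r = 0.
  move=> hc hx; apply: (triv c) => //; apply: conic_in_of_coefs => // i l li.
  case: idx_bij => inv _ invK.
  have := hx (inv (Tagged (fun i => 'I_(deg i + deg i)) (Ordinal li))).
  by rewrite fE invK.
have uA := hermite_mx_unit idx_bij two_neq0.
have gE r : tnth g r = \sum_s hermite_mx K idx r s *: tnth (f 1) s.
  rewrite gE0 hermite_linear; last by apply: size_conic; right.
  rewrite -(hermite_mxE idx_bij r (fun i c => (H 1 i)`_c)).
  by apply: eq_bigr => s _; rewrite fE.
have elow_gt0 d (a : 'I_(d + d)) : (0 < elow d a)%N.
  by rewrite /elow; case: split => l; rewrite subn_gt0.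
have lead_low i (a : 'I_(deg i + deg i)) :
    has_lead (@mdeg (N + N) : measure _) (fun x y => y < x)%N (elow _ a)
      (hermite a (H 1 i)) (low _ i a).
  have lead_shift eps l : eps * eps = 1 -> (l < deg i)%N ->
      has_lead (@mdeg (N + N) : measure _) (fun x y => y < x)%N (deg i - l)
        ((H 1 i \Po ('X + eps%:MP%:P))`_l) ((poly_subst (tangent_line eps) (F i))`_l).
    move=> ee li; apply: has_lead_coef (ltnW li) _; first by move=> d l' e''; lia.
    rewrite comp_poly_subst -[deg i]mul1n; apply: phas_lead_subst => //.
      by move=> x y z t /=; lia.
    by move=> l'; apply: phas_lead_shifted_uconic.
  rewrite /elow /low /hermite; case: split => l.
    have := lead_shift 1 l; rewrite mulr1 mpolyC1; exact.
  have := lead_shift (-1) l; rewrite mulrNN mulr1 mpolyCN polyCN mpolyC1; exact.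
(* Common zeros of the lowest forms at X = eps give a line in direction eps v + w, which is excluded
   unless this vector is zero. The two signs together give v = w = 0, as 2 is invertible. *)
have gt_zero eps x : eps * eps = 1 ->
    (forall i l, (l < deg i)%N -> ((poly_subst (tangent_line eps) (F i))`_l).@[x] = 0) ->
    forall r, eps * x (lshift N r) + x (rshift N r) = 0.
  move=> ee hx; apply: noline => i s.
  have eps0 : eps != 0 by apply: contra_eq_neq ee => ->; rewrite mul0r eq_sym oner_neq0.
  have e20 : eps *+ 2 != 0 by rewrite -mulr_natr mulf_neq0.
  have [m0P hd] : (forall m, @mdeg (N + N) m = 0%N -> m = 0%MM) /\ (forall r,
      deg_in (@mdeg (N + N) : measure _) (pred1 1%N) (eps%:MP * vX r + wX r)).
    by split=> [m /eqP|r]; [rewrite mdeg_eq0 => /eqP | apply: deg_tangent_direction].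
  have := line_in_of_coefs hd m0P (hx i) (s / (eps *+ 2)) => h; rewrite -[RHS]h.
  apply: meval_eq => l; rewrite mulrA divfK //; congr (_ + _); apply: eq_insert0 => r.
  by rewrite mevalD mevalM mevalC !mevalXU.
have lead_le : (\prod_j e j <= \prod_j e' j * \prod_j conic_weight j)%N.
  apply: (lead_degrees_le conic_weight_gt0 _ _ uA gE (ft := f 0) (gt := gt)) => [r|r|r|r|x|x gx|x gx].
  - by rewrite subn_gt0.
  - exact: elow_gt0.
  - rewrite !fE; apply: (has_lead_coef ltn_cmpB (ltnW (ltn_ord _))).
    exact: phas_lead_conic.
  - by rewrite gE0 gtE; apply: lead_low.
  - by apply: zero_of_f; left.
  - apply: (zero_of_f 1 x); first by right.
    move=> r; rewrite (linear_system_inv uA gE r) (raddf_sum (meval x)) big1 //= => s _.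
    by rewrite mevalZ gx mulr0.
  case: idx_bij => inv _ invK.
  have lowx i (a : 'I_(deg i + deg i)) : (low _ i a).@[x] = 0.
    have := gx (inv (Tagged (fun i => 'I_(deg i + deg i)) a)).
    by rewrite gtE invK.
  have p1 : forall r, 1 * x (lshift N r) + x (rshift N r) = 0.
    apply: gt_zero => [|i l li]; first by rewrite mulr1.
    by have := lowx i (lshift _ (Ordinal li)); rewrite /low (unsplitK (inl _)).
  have m1 : forall r, (-1) * x (lshift N r) + x (rshift N r) = 0.
    apply: gt_zero => [|i l li]; first by rewrite mulrNN mulr1.
    by have := lowx i (rshift _ (Ordinal li)); rewrite /low (unsplitK (inr _)).
  have l0 r : x (lshift N r) = 0.
    apply/eqP; have : x (lshift N r) * 2%:R = 0.
      by rewrite mulr_natr mulr2n -[RHS](subr0 0) -{1}(p1 r) -(m1 r); ring.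
    by move/eqP; rewrite mulf_eq0 (negPf two_neq0) orbF.
  have r0 r : x (rshift N r) = 0 by rewrite -[RHS](p1 r) l0 mulr0 add0r.
  by move=> r; rewrite -(splitK r); case: split => r' /=.
(* The inequality reads \prod_i (2 n_i)! <= \prod_i (n_i!)^2 2^(n_i): only the N variables w have
   weight 2, and N is the sum of the n_i. *)
move: lead_le; rewrite leqNgt; apply/negP; rewrite negbK.
rewrite (big_index idx_bij _ (fun i (c : 'I_(deg i + deg i)) => deg i + deg i - c)%N) /=.
rewrite (big_index idx_bij _ (fun i c => elow (deg i) c)) /=.
under eq_bigr => i _.
  rewrite big_split_ord /=.
  rewrite (eq_bigr (fun c : 'I_(deg i) => (deg i - c)%N)); last first.
    by move=> c _; rewrite /elow (unsplitK (inl _)).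
  rewrite prod_rev_ord_fact.
  rewrite (eq_bigr (fun c : 'I_(deg i) => (deg i - c)%N)); last first.
    by move=> c _; rewrite /elow (unsplitK (inr _)).
  rewrite prod_rev_ord_fact; over.
under [X in (_ < X)%N]eq_bigr => i _ do rewrite prod_rev_ord_fact.
have -> : (\prod_j conic_weight j = \prod_i 2 ^ deg i)%N.
  rewrite big_split_ord /= [X in (X * _)%N]big1 => [|r _]; last first.
    by rewrite /conic_weight (unsplitK (inl _)).
  rewrite mul1n (eq_bigr (fun=> 2%N)) => [|r _]; last by rewrite /conic_weight (unsplitK (inr _)).
  by rewrite prod_nat_const card_ord -expn_sum degN.
rewrite -big_split /=; apply: (ltn_prod_pos (Ordinal k0)) => i.
exact: fact_double_gt.
Qed.

End Conic.
End LinesAndConics.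

(** * From solutions of the equations to curves covering X *)

Section Sweeping.
Local Open Scope classical_set_scope.
Variables (K : closedFieldType) (N k : nat).
Variables (F : 'I_k -> {mpoly K[N.+1]}) (deg : 'I_k -> nat).
Hypothesis homF : forall i, F i \is (deg i).-homog.

Lemma curve_through (e : nat) (p : pspace K N) (f : 'I_N.+1 -> {mpoly K[2]}) u1 :
  (0 < e)%N -> (forall j, f j \is e.-homog) ->
  (forall u, u != 0 -> param f u != 0) ->
  (forall i u, (F i).@[fun l => (f l).@[coords u]] = 0) ->
  u1 != 0 -> sval p = <[param f u1]>%VS ->
  exists C, [/\ rational_curve e C, C `<=` \bigcap_i hypersurface (F i) & C p].
Proof.
move=> e0 hf fn0 Ff u1n0 pE.
exists [set q : pspace K N | exists2 u, u != 0 & sval q = <[param f u]>%VS]; split.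
- by split => //; exists f.
- move=> q [u un0 qE] i _ v; rewrite qE => /vlineP [c ->] _.
  rewrite -[RHS](mulr0 (c ^+ deg i)) -(Ff i u) -(dhomog_eval_scale _ _ (homF i)).
  by apply: meval_eq => l; rewrite /coords !mxE.
by exists u1.
Qed.

Lemma pspace_rep (p : pspace K N) : exists2 v : 'rV[K]_N.+1, v != 0 & sval p = <[v]>%VS.
Proof.
case: p => L /= /eqP dL; exists (vpick L).
  by rewrite vpick0 -dimv_eq0 dL.
apply/esym/eqP; rewrite eqEdim -memvE memv_pick /= dL dim_vline.
by rewrite vpick0 -dimv_eq0 dL.
Qed.

Section ThroughPoint.
Variables (p : pspace K N) (v0 : 'rV[K]_N.+1) (j0 : 'I_N.+1).
Hypothesis pE : sval p = <[v0]>%VS.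
Hypothesis v0j0 : v0 0 j0 != 0.
Hypothesis Xp : (\bigcap_i hypersurface (F i)) p.

Let p0 : 'I_N.+1 -> K := coords v0.

Lemma rep_zero i : (F i).@[p0] = 0.
Proof.
apply: (Xp (i := i)) => //; first by rewrite pE memv_line.
by apply: contraNneq v0j0 => ->; rewrite mxE.
Qed.

Let x0 : {mpoly K[2]} := 'X_ord0.
Let x1 : {mpoly K[2]} := 'X_ord_max.

Lemma rV2_neq0 (u : 'rV[K]_2) : u 0 ord0 = 0 -> u 0 ord_max = 0 -> u = 0.
Proof.
move=> u0 u1; apply/rowP => i; rewrite mxE.
case: (unliftP ord0 i) => [j ->|->] //; rewrite ord1.
by rewrite -[RHS]u1; congr (u _ _); apply/val_inj.
Qed.

Lemma insert0_pivot (y : 'I_N -> K) : insert0 j0 y j0 = 0.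
Proof. by rewrite /insert0 unlift_none. Qed.

Lemma insert0_lift (y : 'I_N -> K) r : insert0 j0 y (lift j0 r) = y r.
Proof. by rewrite /insert0 liftK. Qed.

Lemma homog_pow e (c : K) (i : 'I_2) : c *: ('X_i : {mpoly K[2]}) ^+ e \is e.-homog.
Proof.
have h : ('X_i : {mpoly K[2]}) \is 1.-homog by rewrite dhomogX /= mdeg1.
by apply: rpredZ; have := dhomogMn e h; rewrite mul1n.
Qed.

(** Parametrizing by e-th powers of the two homogeneous parameters gives lines for e = 1 and doubled
    lines for e = 2. *)
Lemma line_cover e (y : 'I_N -> K) : (0 < e)%N -> (exists r, y r != 0) ->
  line_in F p0 j0 y ->
  exists C, [/\ rational_curve e C, C `<=` \bigcap_i hypersurface (F i) & C p].
Proof.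
move=> e0 [r yr] hy.
pose f l : {mpoly K[2]} := p0 l *: x0 ^+ e + insert0 j0 y l *: x1 ^+ e.
have fE l u : (f l).@[coords u] = u 0 ord0 ^+ e * p0 l + u 0 ord_max ^+ e * insert0 j0 y l.
  by rewrite mevalD !mevalZ !rmorphXn /= !mevalXU mulrC [X in _ + X]mulrC.
pose u1 : 'rV[K]_2 := \row_i (i == ord0)%:R.
apply: (@curve_through e p f u1) => //.
- by move=> l; apply: rpredD; apply: homog_pow.
- move=> u; apply: contra_neq => /rowP fu.
  have := fu j0; rewrite !mxE fE insert0_pivot mulr0 addr0 => /eqP.
  rewrite mulf_eq0 (negPf v0j0) orbF expf_eq0 e0 => /eqP u0.
  have := fu (lift j0 r); rewrite !mxE fE u0 expr0n gtn_eqF // mul0r add0r insert0_lift.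
  move=> /eqP; rewrite mulf_eq0 (negPf yr) orbF expf_eq0 e0 => /eqP.
  exact: rV2_neq0.
(* Either the value is a multiple of [p0], or dividing by the e-th power of the second parameter
   leads back to [line_in]. *)
- move=> i u; have [u10|u1n0] := eqVneq (u 0 ord_max ^+ e) 0.
    rewrite -[RHS](F_scale_p0 homF rep_zero i (u 0 ord0 ^+ e)).
    by apply: meval_eq => l; rewrite fE u10 mul0r addr0.
  rewrite -[RHS](mulr0 ((u 0 ord_max ^+ e) ^+ deg i)) -(hy i (u 0 ord0 ^+ e / u 0 ord_max ^+ e)).
  rewrite -(dhomog_eval_scale _ _ (homF i)); apply: meval_eq => l.
  by rewrite fE mulrDr mulrA [_ * (_ / _)]mulrC divfK.
- by apply/eqP => /rowP /(_ ord0) /eqP; rewrite !mxE oner_eq0.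
rewrite pE; congr <[_]>%VS; apply/rowP => l.
by rewrite !mxE fE !mxE /= expr1n mul1r expr0n gtn_eqF // mul0r addr0.
Qed.

(* If the parametrization vanishes somewhere, it is the product of a linear
   form and the parametrization of a line through p. *)
Lemma conic_cover c (v w : 'I_N -> K) :
  (forall y, line_in F p0 j0 y -> forall r, y r = 0) ->
  (exists r, v r != 0 \/ w r != 0) -> conic_in F p0 j0 c v w ->
  exists C, [/\ rational_curve 2 C, C `<=` \bigcap_i hypersurface (F i) & C p].
Proof.
move=> noline [r vwr] hc.
pose f l : {mpoly K[2]} := p0 l *: x0 ^+ 2 - (c * p0 l) *: x1 ^+ 2
   + (insert0 j0 v l *: (x0 * x1) + insert0 j0 w l *: x1 ^+ 2).
have fE l u : (f l).@[coords u] = (u 0 ord0 ^+ 2 - c * u 0 ord_max ^+ 2) * p0 l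
   + u 0 ord_max * (insert0 j0 (fun r => u 0 ord0 * v r + u 0 ord_max * w r) l).
  rewrite mevalD mevalB mevalD !mevalZ !rmorphXn /= mevalM !mevalXU /coords /insert0.
  by case: unlift => [r'|]; ring.
pose u1 : 'rV[K]_2 := \row_i (i == ord0)%:R.
apply: (@curve_through 2 p f u1) => //.
- move=> l; apply: rpredD; first by apply: rpredB; apply: homog_pow.
  apply: rpredD; last exact: homog_pow.
  have h i : ('X_i : {mpoly K[2]}) \is 1.-homog by rewrite dhomogX /= mdeg1.
  by apply: rpredZ; apply: (dhomogM (h _) (h _)).
- move=> u; apply: contra_neq => /rowP fu.
  have := fu j0; rewrite !mxE fE insert0_pivot mulr0 addr0 => /eqP.
  rewrite mulf_eq0 (negPf v0j0) orbF subr_eq0 => /eqP u0.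
  have [t0|tn0] := eqVneq (u 0 ord_max) 0.
    apply: rV2_neq0 => //; apply/eqP.
    by move: u0; rewrite t0 expr0n mulr0 => /eqP; rewrite sqrf_eq0.
  exfalso; have vw r' : u 0 ord0 * v r' + u 0 ord_max * w r' = 0.
    have := fu (lift j0 r'); rewrite !mxE fE u0 subrr mul0r add0r insert0_lift => /eqP.
    by rewrite mulf_eq0 (negPf tn0) => /eqP.
  (* At a common zero a^2 = c and w = - a v, so the conic is (s - a) ((s + a) p0 + v). *)
  pose a := u 0 ord0 / u 0 ord_max.
  have ac : a ^+ 2 = c by rewrite /a expr_div_n u0 mulfK // expf_neq0.
  have wE r' : w r' = - (a * v r').
    apply: (mulfI tn0); apply/eqP; rewrite -subr_eq0 mulrN opprK mulrA /a.
    by rewrite [u 0 ord_max * (_ / _)]mulrC divfK // addrC vw.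
  have lin : line_in F p0 j0 v.
    move=> i s.
    pose P := map_poly (meval (fun=> 0)) (poly_subst (uline p0 j0 1 (fun r => (v r)%:MP_[0])) (F i)).
    have PE t : P.[t] = (F i).@[fun l => t * p0 l + insert0 j0 v l].
      rewrite /P eval_uline; apply: meval_eq => l; rewrite mul1r; congr (_ + _).
      by apply: eq_insert0 => r'; rewrite mevalC.
    suff /(congr1 (horner^~ s)) : P = 0 by rewrite PE horner0.
    (* By homogeneity the linear factor comes out with exponent [deg i]; it is cancelled as a
       polynomial, which also covers the parameter where it vanishes. *)
    have Q0 : ('X - a%:P) ^+ deg i * (P \Po ('X + a%:P)) = 0.
      apply: poly_eq0_horner => t; rewrite hornerM horner_exp horner_comp !hornerE PE.
      rewrite -(dhomog_eval_scale _ _ (homF i)) -[RHS](hc i t); apply: meval_eq => l.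
      rewrite -ac /insert0; case: unlift => [r'|]; rewrite ?wE; ring.
    have : P \Po ('X + a%:P) = 0.
      by move/eqP: Q0; rewrite mulf_eq0 expf_eq0 polyXsubC_eq0 andbF => /eqP.
    move/(congr1 (fun q => q \Po ('X - a%:P))).
    by rewrite -comp_polyA comp_polyD comp_polyX comp_polyC subrK comp_polyXr comp_poly0.
  have v0r := noline _ lin r; case: vwr; rewrite ?wE v0r ?mulr0 ?oppr0 eqxx //.
- move=> i u; have [t0|tn0] := eqVneq (u 0 ord_max) 0.
    rewrite -[RHS](F_scale_p0 homF rep_zero i (u 0 ord0 ^+ 2)).
    by apply: meval_eq => l; rewrite fE t0 expr0n mulr0 subr0 mul0r addr0.
  rewrite -[RHS](mulr0 ((u 0 ord_max ^+ 2) ^+ deg i)) -(hc i (u 0 ord0 / u 0 ord_max)).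
  rewrite -(dhomog_eval_scale _ _ (homF i)); apply: meval_eq => l.
  rewrite fE /insert0; case: unlift => [r'|]; by field.
- by apply/eqP => /rowP /(_ ord0) /eqP; rewrite !mxE oner_eq0.
rewrite pE; congr <[_]>%VS; apply/rowP => l.
by rewrite !mxE fE !mxE /= expr1n expr0n mulr0 subr0 mul1r mul0r addr0.
Qed.

End ThroughPoint.

Hypothesis two_neq0 : 2%:R != 0 :> K.

Lemma swept_by_lines : (\sum_i deg i < N)%N ->
  swept_by (@line K N) (\bigcap_i hypersurface (F i)).
Proof.
move=> dN p Xp; have [v0 v0n0 pE] := pspace_rep p.
have [j0 v0j0] := rV0Pn _ v0n0.
have [y [yn0 hy]] := exists_line j0 homF (rep_zero pE v0j0 Xp) dN.
exact: (line_cover pE v0j0 Xp (ltn0Sn 0) yn0 hy).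
Qed.

(** A line of [X] through the point, traversed twice, serves if there is one; its absence is what
    [exists_conic] and [conic_cover] require. *)
Lemma swept_by_conics : (0 < k)%N -> (forall i, 1 < deg i)%N -> (\sum_i deg i = N)%N ->
  swept_by (@quadratic_rational_curve K N) (\bigcap_i hypersurface (F i)).
Proof.
move=> k0 deg1 dN p Xp; have [v0 v0n0 pE] := pspace_rep p.
have [j0 v0j0] := rV0Pn _ v0n0.
have [[y [yn0 hy]]|nol] := pselect (exists y, (exists r, y r != 0) /\ line_in F (coords v0) j0 y).
  exact: (line_cover pE v0j0 Xp (ltn0Sn 1) yn0 hy).
have noline y : line_in F (coords v0) j0 y -> forall r, y r = 0.
  move=> hy r; apply: contrapT => /eqP yr; apply: nol.
  by exists y; split => //; exists r.
have [c [v [w [_ vw hc]]]] := exists_conic homF (rep_zero pE v0j0 Xp) two_neq0 k0 deg1 dN noline.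
exact: (conic_cover pE v0j0 Xp noline vw hc).
Qed.

End Sweeping.

Local Open Scope classical_set_scope.

Theorem mainTheorem2 (R : realType) (k n d : nat) (deg : 'I_k -> nat)
    (F : 'I_k -> {mpoly R[i][(k + n - 1).+1]})
    (X : set (pspace R[i] (k + n - 1)))
    (hk : (1 <= k)%N) (hn : (3 <= n)%N)
    (hF : forall i, F i != 0 /\ F i \is (deg i).-homog)
    (hdeg : forall i, (1 < deg i)%N)
    (hX : X = \bigcap_i hypersurface (F i))
    (hdim : has_dimension X (n - 1))
    (hsum : (\sum_(i < k) deg i)%N = d)
    (hFano : (d <= k + n - 1)%N) :
  (d = (k + n - 1)%N -> swept_by (@quadratic_rational_curve _ _) X) /\
  ((d < k + n - 1)%N -> swept_by (@line _ _) X).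
Proof.
have hom i : F i \is (deg i).-homog by case: (hF i).
have two_neq0 : 2%:R != 0 :> R[i] by rewrite Num.Theory.pnatr_eq0.
rewrite hX -hsum; split=> [dN|dN]; last exact: swept_by_lines.
exact: swept_by_conics.
Qed.
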